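(* For a separable complex Banach space $E$ the following assertions are equivalent: (i) The Banach space $E$ does not contain a copy of $c_0$. (ii) For every power-bounded linear operator $T\in\mathscr{L}(E)$ and every $x\in E$, the orbit $\{T^nx:n\in\mathbb{N}\}\subseteq E$ is relatively compact if and only if both the set $\{T^{n+1}x-T^nx:n\in\mathbb{N}\}\subseteq E$ is relatively compact and the sequence $(I-P)(T^nx-x)$ is convergent in $E$ for $n\to\infty$.
   Context: $\mathscr{L}(E)$ denotes the bounded linear operators on $E$; $T$ is power-bounded if $\sup_{n\in\mathbb{N}}\|T^n\|<\infty$. $c_0$ is the Banach space of null sequences with the supremum norm; ''$E$ contains a copy of $c_0$'' means $E$ has a closed subspace linearly homeomorphic to $c_0$. For power-bounded $T$, let $E_{\mathrm{aap}}$ be the set of all $x\in E$ for which $\{T^nx:n\in\mathbb{N}\}$ is relatively compact (asymptotically almost periodic vectors); it is a closed $T$-invariant subspace. By the Jacobs–de Leeuw–Glicksberg decomposition applied to $T|_{E_{\mathrm{aap}}}$, there is a bounded projection $P\in\mathscr{L}(E_{\mathrm{aap}})$ (depending on $T$) commuting with $T|_{E_{\mathrm{aap}}}$ whose range is $E_{\mathrm{r}}=\overline{\operatorname{span}}\{y\in E_{\mathrm{aap}}: Ty=\lambda y \text{ for some } \lambda\in\mathbb{C},\ |\lambda|=1\}$ and whose kernel is $E_{\mathrm{s}}=\{y\in E_{\mathrm{aap}}: T^ny\to 0 \text{ as } n\to\infty\}$. The projection $P$ is determined by these properties. If $\{T^{n+1}x-T^nx:n\in\mathbb{N}\}$ is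 relatively compact, i.e. $(T-I)x\in E_{\mathrm{aap}}$, then $T^nx-x\in E_{\mathrm{aap}}$ for all $n\in\mathbb{N}$, so $(I-P)(T^nx-x)$ is well defined. *)

(* Defs.v *)
(* MathComp / MathComp-Analysis; the complex scalars are R[i] for R : realType. *)
From HB Require Import structures.
From mathcomp Require Import all_boot all_order all_algebra.
From mathcomp Require Import all_classical all_reals.
From mathcomp Require Import ereal topology normedtype.
From mathcomp Require Import complex.

Set Implicit Arguments.
Unset Strict Implicit.
Unset Printing Implicit Defensive.

Import Order.TTheory GRing.Theory Num.Theory.
Import numFieldNormedType.Exports.

Local Open Scope classical_set_scope.
Local Open Scope ring_scope.
Local Open Scope complex_scope.

Section RealNorm.
Context {R : realType}.

(* The norm of a normed module over R[i] is R[i]-valued (a nonnegative real);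
   rnorm is the same number as an element of R. *)
Definition rnorm (V : normedModType R[i]) (x : V) : R := complex.Re `|x|.

Lemma rnormE (V : normedModType R[i]) (x : V) : `|x| = (rnorm x)%:C.
Proof. by rewrite /rnorm RRe_real ?normr_real. Qed.

Lemma rnorm_ge0 (V : normedModType R[i]) (x : V) : 0 <= rnorm x.
Proof. by rewrite -(@lecR R) -rnormE normr_ge0. Qed.

Lemma rnormD (V : normedModType R[i]) (x y : V) :
  rnorm (x + y) <= rnorm x + rnorm y.
Proof. by rewrite -(@lecR R) rmorphD/= -!rnormE ler_normD. Qed.

Lemma rnormZ (V : normedModType R[i]) (a : R[i]) (x : V) :
  rnorm (a *: x) = rnorm (a : R[i]^o) * rnorm x.
Proof.
by apply: (@complexI R); rewrite rmorphM/= -!rnormE normrZ.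
Qed.

Lemma rnorm0_eq0 (V : normedModType R[i]) (x : V) : rnorm x = 0 -> x = 0.
Proof. by move=> x0; apply/eqP; rewrite -normr_eq0 rnormE x0. Qed.

End RealNorm.

Section NullSequences.
Variable R : realType.

Definition null_seq : {pred nat -> R[i]^o} :=
  fun u => `[< u n @[n --> \oo] --> (0 : R[i]^o) >].

Lemma null_seqP (u : nat -> R[i]^o) :
  reflect (u n @[n --> \oo] --> (0 : R[i]^o)) (u \in null_seq).
Proof. exact: asboolP. Qed.

Lemma null_seq_submod_closed : submod_closed null_seq.
Proof.
split; first by apply/null_seqP; exact: cvg_cst.
move=> a u v /null_seqP u0 /null_seqP v0; apply/null_seqP.
have := cvgD (cvgZl_tmp (k := a) u0) v0.
by rewrite scaler0 addr0; exact.
Qed.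

HB.instance Definition _ :=
  GRing.isSubmodClosed.Build R[i] (nat -> R[i]^o) null_seq
    null_seq_submod_closed.

Record c0 := C0 { c0_val :> nat -> R[i]^o; c0_valP : c0_val \in null_seq }.

HB.instance Definition _ := [isSub for c0_val].
HB.instance Definition _ := [Choice of c0 by <:].
HB.instance Definition _ := [SubChoice_isSubLmodule of c0 by <:].

Definition c0_norm (u : c0) : R[i] := (sup (range (fun n => rnorm (u n))))%:C.

Lemma c0_has_sup (u : c0) : has_sup (range (fun n => rnorm (u n))).
Proof.
split; first by exists (rnorm (u 0)), 0.
have /null_seqP u0 := c0_valP u.
have /cvgr0_norm_le/(_ 1 ltr01)[N _ uN] := u0.
exists (1 + \sum_(i < N) rnorm (u i)) => _ [n _ <-].
have s0 : 0 <= \sum_(i < N) rnorm (u i).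
  by apply: sumr_ge0 => i _; exact: rnorm_ge0.
have [Nn|nN] := leqP N n.
  have : rnorm (u n) <= 1 by rewrite -(@lecR R) -rnormE; exact: uN.
  by move=> /le_trans; apply; rewrite lerDl.
rewrite (bigD1 (Ordinal nN))//= addrCA lerDl addr_ge0//.
by apply: sumr_ge0 => i _; exact: rnorm_ge0.
Qed.

Lemma rnorm_le_c0_norm (u : c0) n : (rnorm (u n))%:C <= c0_norm u.
Proof. by rewrite lecR; apply: sup_ubound; [case: (c0_has_sup u)|exists n]. Qed.

Lemma c0_norm_le (u : c0) (M : R) :
  (forall n, rnorm (u n) <= M) -> c0_norm u <= M%:C.
Proof.
move=> uM; rewrite lecR; apply: ge_sup; first by case: (c0_has_sup u).
by move=> _ [n _ <-].
Qed.

Lemma c0_normD (u v : c0) : c0_norm (u + v) <= c0_norm u + c0_norm v.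
Proof.
rewrite -rmorphD/=; apply: c0_norm_le => n /=.
rewrite (le_trans (rnormD _ _))// lerD// -(@lecR R); exact: rnorm_le_c0_norm.
Qed.

Lemma c0_normZ (a : R[i]) (u : c0) : c0_norm (a *: u) = `|a| * c0_norm u.
Proof.
rewrite [`|a|](rnormE (a : R[i]^o)) -rmorphM/=; apply/le_anti/andP; split.
  apply: c0_norm_le => n /=; rewrite rnormZ ler_wpM2l ?rnorm_ge0//.
  by rewrite -(@lecR R); exact: rnorm_le_c0_norm.
have [->|a0] := eqVneq (rnorm (a : R[i]^o)) 0.
  by rewrite mul0r; apply: le_trans (rnorm_le_c0_norm _ 0); rewrite lecR rnorm_ge0.
have {}a0 : 0 < rnorm (a : R[i]^o) by rewrite lt_neqAle eq_sym a0 rnorm_ge0.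
rewrite lecR mulrC -ler_pdivlMr//.
apply: ge_sup; first by case: (c0_has_sup u).
move=> _ [n _ <-]; rewrite ler_pdivlMr// mulrC -rnormZ -(@lecR R).
exact: (rnorm_le_c0_norm (a *: u) n).
Qed.

Lemma c0_norm0_eq0 (u : c0) : c0_norm u = 0 -> u = 0.
Proof.
move=> u0; apply/val_inj/funext => n; apply: rnorm0_eq0; apply/le_anti.
by rewrite rnorm_ge0 andbT -(@lecR R) -[X in _ <= X]u0 rnorm_le_c0_norm.
Qed.

HB.instance Definition _ :=
  Lmodule_isNormed.Build R[i] c0 c0_normD c0_normZ c0_norm0_eq0.

End NullSequences.

Section Definitions.
Variable R : realType.

Definition separable_space (T : topologicalType) : Prop :=
  exists2 D : set T, countable D & dense D.

Definition contains_copy_of_c0 (E : normedModType R[i]) : Prop :=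
  exists J : {linear c0 R -> E},
    [/\ continuous J, closed (range J) &
      exists2 G : E -> c0 R, cancel J G & {within range J, continuous G}].

Section Operators.
Variable E : normedModType R[i].

(* Operator norm of the restriction of f to D. *)
Definition opnorm (D : set E) (f : E -> E) : \bar R :=
  ereal_sup [set (rnorm (f x))%:E | x in D `&` [set x | rnorm x <= 1]].

Definition bounded_op (D : set E) (f : E -> E) : Prop := (opnorm D f < +oo)%E.

Definition power_bounded (T : E -> E) : Prop :=
  (ereal_sup (range (fun n => opnorm setT (iter n T))) < +oo)%E.

(* The library's precompact: contained in a closed compact set, equivalently
   with compact closure (precompactE). *)
Definition aap (T : E -> E) : set E :=
  [set x | precompact (range (fun n => iter n T x))].

Definition lin_span (A : set E) : set E :=
  [set z | exists n (c : 'I_n -> R[i]) (v : 'I_n -> E),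
    (forall i, A (v i)) /\ z = \sum_(i < n) c i *: v i].

Definition rev_part (T : E -> E) : set E :=
  closure (lin_span [set y | aap T y /\
    exists2 lambda : R[i], `|lambda| = 1 & T y = lambda *: y]).

Definition stable_part (T : E -> E) : set E :=
  [set y | aap T y /\ iter n T y @[n --> \oo] --> (0 : E)].

(* P represents an operator on the subspace aap T; its values outside aap T are
   irrelevant, and on aap T they are unique (jdlg_projection_unique). *)
Definition jdlg_projection (T P : E -> E) : Prop :=
  [/\ forall y, aap T y -> aap T (P y),
      forall (a : R[i]) y z, aap T y -> aap T z ->
        P (a *: y + z) = a *: P y + P z,
      bounded_op (aap T) P &
      [/\ forall y, aap T y -> P (P y) = P y,
          forall y, aap T y -> P (T y) = T (P y),
          P @` aap T = rev_part T &
          [set y | aap T y /\ P y = 0] = stable_part T]].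

Lemma aap_linear (T : {linear E -> E}) (a : R[i]) (y z : E) :
  aap T y -> aap T z -> aap T (a *: y + z).
Proof.
rewrite /aap /= !precompactE => cy cz.
pose f (p : E * E) : E := a *: p.1 + p.2.
have cf : continuous f.
  move=> p; apply: cvgD; last exact: cvg_snd.
  by apply: cvgZl_tmp; exact: cvg_fst.
have cyz : compact (f @` (closure (range (fun n => iter n T y)) `*`
                          closure (range (fun n => iter n T z)))).
  apply: continuous_compact; last exact: compact_setX.
  exact: continuous_subspaceT.
rewrite -precompactE.
apply: precompact_subset (compact_precompact (@norm_hausdorff _ E) cyz).
move=> _ [n _ <-].
exists (iter n T y, iter n T z).
  by split; apply: subset_closure; exists n.
rewrite /f /=; elim: n => //= n <-; by rewrite linearP.
Qed.

Lemma jdlg_projection_unique (T : {linear E -> E}) (P P' : E -> E) :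
  jdlg_projection T P -> jdlg_projection T P' ->
  forall y, aap T y -> P y = P' y.
Proof.
move=> [PA PL _ [PP _ Pr Pk]] [PA' PL' _ [PP' _ Pr' Pk']] y Ay.
have sub_lin Q : (forall (a : R[i]) u v, aap T u -> aap T v ->
    Q (a *: u + v) = a *: Q u + Q v) -> Q (y - P' y) = Q y - Q (P' y).
  move=> QL; have := QL (-1) (P' y) y (PA' _ Ay) Ay.
  by rewrite !scaleN1r addrC => ->; rewrite addrC.
have : [set v | aap T v /\ P v = 0] (y - P' y).
  rewrite Pk -Pk' /=; split; last by rewrite sub_lin// PP'// subrr.
  by rewrite addrC -scaleN1r; apply: aap_linear => //; exact: PA'.
move=> /= [_]; rewrite sub_lin// => /eqP; rewrite subr_eq0 => /eqP ->.
have : (P @` aap T) (P' y) by rewrite Pr -Pr'; exists y.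
by move=> [v Av <-]; rewrite PP.
Qed.

End Operators.
End Definitions.

(* Main.v *)
Require Import Defs.
From HB Require Import structures.
From mathcomp Require Import all_boot all_order all_algebra.
From mathcomp Require Import all_classical all_reals.
From mathcomp Require Import ereal topology normedtype.
From mathcomp Require Import complex.
From mathcomp Require Import ring lra.

Set Implicit Arguments.
Unset Strict Implicit.
Unset Printing Implicit Defensive.

Import Order.TTheory GRing.Theory Num.Theory.
Import numFieldNormedType.Exports.

Local Open Scope classical_set_scope.
Local Open Scope ring_scope.


(** Suppose first that [E] contains no copy of [c0 R], that the increments of
    the orbit of [x] are relatively compact and that its stable parts converge.
    Then [f n = P (iter n T x - x)] is a bounded cocycle,
    [f (n + m) = f n + iter n T (f m)], with values in the reversible part, and
    the orbit of [x] is the sum of [f] and of a convergent sequence, so what has to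
    be shown is that [f] has totally bounded range.  This is a form of Kadets'
    theorem on bounded integrals of almost periodic functions ([kadets]).
    Vectors of the reversible part are recurrent: among any infinitely many
    times there are two whose difference [m] makes [iter m T] almost fix finitely
    many given vectors.  If the range of [f] is not totally bounded, such
    differences [m] exist with [f m] bounded away from [0], and choosing them
    successively makes [f] nearly additive on them.  Hence the subset sums of
    the vectors [f m] are bounded, and [bessaga_pelczynski] produces a copy of
    [c0 R].  That theorem is proved with norming functionals ([hahn_banach]) and
    Rosenthal's disjointness lemma ([rosenthal]).  The converse implication
    between orbits and increments holds in every space, since the orbit of the
    stable component of [x] tends to [0].

    Suppose conversely that [J] embeds [c0 R] in [E].  The Hahn-Banach theorem
    extends the coordinate functionals of the copy to bounded functionals [f n]
    on [E], and [h n = f n + f 0].  For unimodular [l n], different from [1] for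
    [n > 0] and tending to [1], the operator
    [T z = z + J (n |-> (l n - 1) * h n z)] rotates the [n]-th coordinate by
    [l n]; it is power-bounded, and its increments lie in the copy.  Its almost
    periodic vectors are those with [h n z] tending to [0], they all belong to
    the reversible part, so the projection is the identity and the convergence
    condition is void.  The image of the first unit vector has [h n = 1] for all
    [n > 0]: its increments are almost periodic but its orbit is not relatively
    compact ([rotated_copy_counterexample]). *)

(** * Real-valued norms, limits and closures *)

Section RealValuedNorm.
Local Open Scope complex_scope.
Context {R : realType}.
Implicit Type V : normedModType R[i].

Lemma rnorm0 V : rnorm (0 : V) = 0.
Proof. by rewrite /rnorm normr0. Qed.

Lemma rnormN V (x : V) : rnorm (- x) = rnorm x.
Proof. by rewrite /rnorm normrN. Qed.

Lemma rnormBC V (x y : V) : rnorm (x - y) = rnorm (y - x).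
Proof. by rewrite -rnormN opprB. Qed.

Lemma rnormB V (x y : V) : rnorm (x - y) <= rnorm x + rnorm y.
Proof. by rewrite -(rnormN y) rnormD. Qed.

Lemma rnorm_distD V (y x z : V) : rnorm (x - z) <= rnorm (x - y) + rnorm (y - z).
Proof. by rewrite -[x - z](subrKA y) rnormD. Qed.

Lemma rnorm_addB V (x y : V) : rnorm x - rnorm y <= rnorm (x + y).
Proof. by rewrite lerBlDr -{1}[x](addrK y) rnormB. Qed.

Lemma rnorm_sum V (I : Type) (s : seq I) (P : pred I) (F : I -> V) :
  rnorm (\sum_(i <- s | P i) F i) <= \sum_(i <- s | P i) rnorm (F i).
Proof.
elim/big_rec2: _ => [|i y x _ le_xy]; first by rewrite rnorm0.
by rewrite (le_trans (rnormD _ _))// lerD2l.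
Qed.

Lemma rnorm1 : rnorm (1 : R[i]^o) = 1.
Proof. by rewrite /rnorm normr1. Qed.

Lemma rnormM (a b : R[i]) :
  rnorm (a * b : R[i]^o) = rnorm (a : R[i]^o) * rnorm (b : R[i]^o).
Proof. exact: rnormZ. Qed.

Lemma rnormX (a : R[i]) n :
  rnorm (a ^+ n : R[i]^o) = rnorm (a : R[i]^o) ^+ n.
Proof. by elim: n => [|n IHn]; rewrite ?rnorm1// !exprS rnormM IHn. Qed.

Lemma rnorm_real (r : R) : rnorm (r%:C : R[i]^o) = `|r|.
Proof. by rewrite /rnorm normc_def /= expr0n /= addr0 sqrtr_sqr. Qed.

Lemma normr_rnorm (a : R[i]) : `|a| = (rnorm (a : R[i]^o))%:C.
Proof. exact: (rnormE (a : R[i]^o)). Qed.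

Lemma normr_Re_le (a : R[i]) : `|complex.Re a| <= rnorm (a : R[i]^o).
Proof. by rewrite -(@lecR R) -normr_rnorm normc_ge_Re. Qed.

Lemma Re_le_rnorm (a : R[i]) : complex.Re a <= rnorm (a : R[i]^o).
Proof. exact: le_trans (ler_norm _) (normr_Re_le a). Qed.

Lemma rnorm_i : rnorm ('i : R[i]^o) = 1.
Proof. by rewrite /rnorm normc_def /= expr0n expr1n /= add0r sqrtr1. Qed.

Lemma normr_Im_le (a : R[i]) : `|complex.Im a| <= rnorm (a : R[i]^o).
Proof.
by have := normr_Re_le (a * 'i); rewrite ReiNIm normrN rnormM rnorm_i mulr1.
Qed.

Lemma norm_ltE V (x : V) (e : R) : (`|x| < e%:C) = (rnorm x < e).
Proof. by rewrite rnormE ltcR. Qed.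

Lemma gt0_complex (e : R[i]) : 0 < e -> exists2 r : R, 0 < r & e = r%:C.
Proof.
move=> e0; have := e0; have /complex_realP[r ->] : e \is Num.real.
  exact: gtr0_real.
by rewrite (@ltcR R 0) => r0; exists r.
Qed.

Lemma rcvgP V (u : nat -> V) (l : V) :
  u n @[n --> \oo] --> l <->
  forall e : R, 0 < e -> exists N, forall n, (N <= n)%N -> rnorm (u n - l) < e.
Proof.
split=> [/cvgrPdist_lt ul e e0|ul].
  have /ul[N _ uN] : 0 < e%:C by rewrite (@ltcR R 0).
  by exists N => n /uN /=; rewrite norm_ltE rnormBC.
apply/cvgrPdist_lt => _ /gt0_complex[r /ul[N uN] ->].
by exists N => // n /uN; rewrite /= norm_ltE rnormBC.
Qed.

Lemma rcvg_cauchy (V : completeNormedModType R[i]) (u : nat -> V) :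
  (forall e : R, 0 < e ->
     exists N, forall n, (N <= n)%N -> rnorm (u n - u N) < e) ->
  exists l : V, u n @[n --> \oo] --> l.
Proof.
move=> uC; suff uc : cvg (u n @[n --> \oo]) by exists (lim (u n @[n --> \oo])).
apply/cauchy_cvgP/cauchyP => _ /gt0_complex[r /uC[N uN] ->].
by exists (u N), N => // n /uN; rewrite -ball_normE /= norm_ltE rnormBC.
Qed.

Lemma rclosureP V (A : set V) (x : V) :
  closure A x <->
  forall e : R, 0 < e -> exists2 y, A y & rnorm (x - y) < e.
Proof.
split=> [xA e e0|xA B /nbhs_ballP[_ /= /gt0_complex[r r0 ->] rB]].
  have [|y [Ay]] := xA (ball x e%:C); last first.
    by rewrite -ball_normE /= norm_ltE => xy; exists y.
  by apply: nbhsx_ballx; rewrite (@ltcR R 0).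
have [y Ay xy] := xA _ r0; exists y; split=> //; apply: rB.
by rewrite -ball_normE /= norm_ltE.
Qed.

Lemma rcvg_rnorm_le V (u : nat -> V) (l : V) (c : R) N :
  u n @[n --> \oo] --> l -> (forall n, (N <= n)%N -> rnorm (u n) <= c) ->
  rnorm l <= c.
Proof.
move=> /rcvgP ul uc; apply/ler_addgt0Pr => e /ul[N' uN'].
have := uN' _ (leq_maxr N N'); have := uc _ (leq_maxl N N').
have := rnormB (u (maxn N N')) (u (maxn N N') - l); rewrite subKr; lra.
Qed.

Lemma rcvg_rnorm_ge V (u : nat -> V) (l : V) (c : R) N :
  u n @[n --> \oo] --> l -> (forall n, (N <= n)%N -> c <= rnorm (u n)) ->
  c <= rnorm l.
Proof.
move=> /rcvgP ul uc; apply/ler_addgt0Pr => e /ul[N' uN'].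
have := uN' _ (leq_maxr N N'); have := uc _ (leq_maxl N N').
have := rnormD (u (maxn N N') - l) l; rewrite subrK; lra.
Qed.

(** In a complete space these are the precompact sets. *)
Definition totally_bounded V (A : set V) := forall e : R, 0 < e ->
  exists s : seq V, forall x, A x -> exists2 y, y \in s & rnorm (x - y) < e.

Lemma precompact_totally_bounded V (A : set V) :
  precompact A -> totally_bounded A.
Proof.
rewrite precompactE => cA e e0.
have /= := cA; rewrite compact_cover => /(_ V setT (fun x => ball x e%:C)).
case=> [x _|x _|D _ Dcov].
- by apply: ball_open; rewrite (@ltcR R 0).
- by exists x => //; apply: ballxx; rewrite (@ltcR R 0).
exists (finmap.enum_fset D) => x /(@subset_closure _ A) /Dcov[y /= yD].
rewrite -ball_normE /= norm_ltE rnormBC => xy.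
by exists y.
Qed.

(** An ultrafilter on a totally bounded set contains arbitrarily small balls,
    so it is Cauchy and completeness makes it converge. *)
Lemma totally_bounded_precompact (V : completeNormedModType R[i]) (A : set V) :
  totally_bounded A -> precompact A.
Proof.
move=> tA; rewrite precompactE compact_ultra => F UF FA.
have cF : cauchy F.
  apply/cauchyP => _ /gt0_complex[r r0 ->].
  have r2 : 0 < r / 2 by lra.
  have [s sA] := tA _ r2.
  have {}sA : closure A `<=` \bigcup_(y in [set` s]) ball y r%:C.
    move=> x /rclosureP/(_ _ r2)[z Az xz].
    have [y ys zy] := sA _ Az; exists y => //.
    rewrite -ball_normE /= norm_ltE rnormBC.
    by have := rnorm_distD z x y; lra.
  have : F (\bigcup_(y in [set` s]) ball y r%:C) by apply: filterS FA.
  elim: s {sA} => [|y s IHs].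
    move=> F0; suff : F set0 by move=> /filter_not_empty.
    by apply: filterS F0 => z [].
  have [Fy _|nFy FU] := pselect (F (ball y r%:C)); first by exists y.
  apply: IHs; have [//|Fn] := in_ultra_setVsetC (ball y r%:C) UF.
  apply: filterS (filterI FU Fn) => z [[w]] /=.
  by rewrite inE => /predU1P[->//|ws wz _]; exists w.
have /cauchy_cvg cvF := cF; exists (lim F); split=> //.
apply: (@closed_closure _ A) => B /cvF FB.
by have [x] := filter_ex (filterI FA FB); exists x.
Qed.

End RealValuedNorm.

(** * The Hahn-Banach theorem *)

Section HahnBanach.
Local Open Scope complex_scope.
Context {R : realType} {V : lmodType R[i]}.
Implicit Types (p q : V -> R) (x y : V).

Definition sublinear p :=
  (forall x y, p (x + y) <= p x + p y) /\
  (forall (t : R) x, 0 <= t -> p (t%:C *: x) <= t * p x).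

Lemma sublinear0 p : sublinear p -> p 0 = 0.
Proof.
move=> [pD pZ]; have := pZ 0 0 (lexx 0); have := pD 0 0.
by rewrite scale0r addr0 mul0r; lra.
Qed.

Lemma sublinearN p x : sublinear p -> - p (- x) <= p x.
Proof. by move=> sp; have := sp.1 x (- x); rewrite subrr sublinear0//; lra. Qed.

Lemma sublinearZ p (t : R) x : sublinear p -> 0 <= t -> p (t%:C *: x) = t * p x.
Proof.
move=> sp t0; have [->|tN0] := eqVneq t 0.
  by rewrite scale0r mul0r sublinear0.
have {}t0 : 0 < t by rewrite lt_neqAle eq_sym tN0.
apply/le_anti; rewrite sp.2 ?(ltW t0)//=.
have := sp.2 t^-1 (t%:C *: x); rewrite invr_ge0 => /(_ (ltW t0)).
by rewrite scalerA -rmorphM/= mulVf// scale1r ler_pdivlMl.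
Qed.

(** Lowering a sublinear [p] along a convex cone of pairs [(y, s)] with
    [s <= p y]: the infimum is again sublinear, stays below [p], and sends
    [- y] below [- s].  Both the minimality argument and the prescription of
    values on a subspace below are instances of this construction. *)
Lemma sublinear_lower p (C : V -> R -> Prop) :
  sublinear p -> C 0 0 -> (forall y s, C y s -> s <= p y) ->
  (forall y z s t, C y s -> C z t -> C (y + z) (s + t)) ->
  (forall (t : R) y s, 0 <= t -> C y s -> C (t%:C *: y) (t * s)) ->
  exists q, [/\ sublinear q, forall x, q x <= p x &
    forall x y s, C y s -> q x <= p (x + y) - s].
Proof.
move=> sp C00 Cp CD CZ.
pose A x := [set r | exists y s, C y s /\ r = p (x + y) - s].
have lbA x : has_lbound (A x).
  exists (- p (- x)) => _ [y [s [Cys ->]]].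
  by have := sp.1 (x + y) (- x); rewrite addrAC subrr add0r; have := Cp _ _ Cys; lra.
have infA x : has_inf (A x) by split=> //; exists (p (x + 0) - 0), 0, 0.
have qC x y s : C y s -> inf (A x) <= p (x + y) - s.
  by move=> Cys; apply: ge_inf => //; exists y, s.
exists (fun x => inf (A x)); split=> //; last first.
  by move=> x; have := qC x _ _ C00; rewrite addr0 subr0.
split=> [x y|t x t0].
  apply/ler_addgt0Pr => e e0; have e2 : 0 < e / 2 by lra.
  have [_ [y1 [s1 [C1 ->]]] h1] := inf_adherent e2 (infA x).
  have [_ [y2 [s2 [C2 ->]]] h2] := inf_adherent e2 (infA y).
  have := qC (x + y) _ _ (CD _ _ _ _ C1 C2).
  by have := sp.1 (x + y1) (y + y2); rewrite addrACA; lra.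
apply/ler_addgt0Pr => e e0; have e2 : 0 < e / (t + 1) by apply: divr_gt0; lra.
have [_ [y1 [s1 [C1 ->]]] h1] := inf_adherent e2 (infA x).
apply: (le_trans (qC _ _ _ (CZ _ _ _ t0 C1))).
rewrite -scalerDr sublinearZ// -mulrBr.
have t1 : 0 < t + 1 by lra.
have : t * (e / (t + 1)) <= e by rewrite mulrA ler_pdivrMr//; nra.
by nra.
Qed.

(** The infimum of a chain of sublinear functionals below [p] is finite, since
    each of them is at least [- p (- x)] at [x], so Zorn's lemma applies. *)
Lemma sublinear_minimal p : sublinear p ->
  exists q, [/\ sublinear q, forall x, q x <= p x &
    forall q', sublinear q' -> (forall x, q' x <= q x) -> q' = q].
Proof.
move=> sp; pose T := {q | sublinear q /\ forall x, q x <= p x}.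
pose S (a b : T) : bool := `[< forall x, sval b x <= sval a x >].
have [//|a b c /asboolP ab /asboolP bc|a b|A totA|[q [sq qp]] maxq] := @Zorn T S.
- by move=> a; apply/asboolP => x.
- by apply/asboolP => x; apply: le_trans (bc x) (ab x).
- case: a b => [a Pa] [b Pb] /asboolP/= ba /asboolP/= ab.
  have eq_ab : a = b by apply/funext => x; apply/le_anti; rewrite ab ba.
  by move: Pa Pb; rewrite eq_ab => Pa Pb; congr exist; exact: Prop_irrelevance.
- have [[a0 Aa0]|A0] := pselect (exists a, A a); last first.
    have pP : sublinear p /\ forall x, p x <= p x by [].
    by exists (exist _ p pP : T) => s As; exfalso; apply: A0; exists s.
  pose B x := [set sval a x | a in A].
  have lbB x : has_lbound (B x).
    exists (- p (- x)) => _ [[a [sa ap]] Aa <-] /=.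
    by have := sublinearN x sa; have := ap (- x); lra.
  have infB x : has_inf (B x) by split=> //; exists (sval a0 x), a0.
  have qB x a : A a -> inf (B x) <= sval a x.
    by move=> Aa; apply: ge_inf => //; exists a.
  have qP : sublinear (fun x => inf (B x)) /\ forall x, inf (B x) <= p x.
    split; last by move=> x; apply: le_trans (qB x a0 Aa0) _; case: (a0) => ? [].
    split=> [x y|t x t0].
      apply/ler_addgt0Pr => e e0; have e2 : 0 < e / 2 by lra.
      have [_ [a Aa <-] h1] := inf_adherent e2 (infB x).
      have [_ [b Ab <-] h2] := inf_adherent e2 (infB y).
      have sD (c : T) : sval c (x + y) <= sval c x + sval c y.
        by case: c => c [[cD cZ] cp]; exact: cD.
      have [/asboolP ab|/asboolP ba] := totA _ _ Aa Ab.
        by have := qB (x + y) b Ab; have := sD b; have := ab x; lra.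
      by have := qB (x + y) a Aa; have := sD a; have := ba y; lra.
    apply/ler_addgt0Pr => e e0.
    have e2 : 0 < e / (t + 1) by apply: divr_gt0; lra.
    have [_ [a Aa <-] h1] := inf_adherent e2 (infB x).
    apply: (le_trans (qB _ _ Aa));
    rewrite (sublinearZ _ _ t0); last by case: (a) => a' [? ?].
    have : t * (e / (t + 1)) <= e by rewrite mulrA ler_pdivrMr; nra.
    by nra.
  exists (exist _ (fun x => inf (B x)) qP : T) => a Aa.
  by apply/asboolP => x; exact: qB.
exists q; split=> // q' sq' q'q.
have q'P : sublinear q' /\ forall x, q' x <= p x.
  by split=> // x; apply: le_trans (q'q x) (qp x).
by have /(congr1 sval) := maxq (exist _ q' q'P) (asboolT q'q).
Qed.

(** A minimal sublinear functional is linear: lowering it along the ray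
    spanned by [(y, q y)] cannot change it, which says that
    [q x <= q (x + y) - q y]. *)
Lemma minimal_additive q : sublinear q ->
  (forall q', sublinear q' -> (forall x, q' x <= q x) -> q' = q) ->
  forall x y, q (x + y) = q x + q y.
Proof.
move=> sq minq x y; apply/le_anti; rewrite sq.1 /=.
pose C z s := exists2 t : R, 0 <= t & z = t%:C *: y /\ s = t * q y.
have [||||q' [sq' q'q q'C]] := @sublinear_lower q C sq.
- by exists 0 => //; rewrite scale0r mul0r.
- by move=> z s [t t0 [-> ->]]; rewrite sublinearZ.
- move=> _ _ _ _ [s s0 [-> ->]] [t t0 [-> ->]]; exists (s + t).
    exact: addr_ge0.
  by rewrite rmorphD/= scalerDl mulrDl.
- move=> t _ _ t0 [s s0 [-> ->]]; exists (t * s); first exact: mulr_ge0.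
  by rewrite rmorphM/= scalerA mulrA.
have := q'C x y (q y); rewrite (minq _ sq' q'q) => H.
have /H : C y (q y) by exists 1 => //; rewrite scale1r mul1r.
by lra.
Qed.

Lemma real_hahn_banach p (C : V -> R -> Prop) :
  sublinear p -> C 0 0 -> (forall y s, C y s -> s <= p y) ->
  (forall y z s t, C y s -> C z t -> C (y + z) (s + t)) ->
  (forall (t : R) y s, 0 <= t -> C y s -> C (t%:C *: y) (t * s)) ->
  exists g : V -> R, [/\ forall x y, g (x + y) = g x + g y,
    forall (t : R) x, g (t%:C *: x) = t * g x, forall x, g x <= p x &
    forall y s, C y s -> s <= g y].
Proof.
move=> sp C00 Cp CD CZ.
have [p' [sp' p'p p'C]] := sublinear_lower sp C00 Cp CD CZ.
have [g [sg gp' ming]] := sublinear_minimal sp'.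
have gD := minimal_additive sg ming.
have gN x : g (- x) = - g x by have := gD x (- x); rewrite subrr sublinear0//; lra.
exists g; split=> // [t x|x|y s Cys].
- have [t0|t0] := leP 0 t; first by rewrite sublinearZ.
  have := @sublinearZ g (- t) x sg; rewrite rmorphN scaleNr gN.
  by move=> /(_ _)/eqP; rewrite oppr_ge0 mulNr eqr_opp => /(_ (ltW t0))/eqP.
- exact: le_trans (gp' x) (p'p x).
- have := p'C (- y) _ _ Cys; rewrite addNr sublinear0//.
  by have := gp' (- y); rewrite gN; lra.
Qed.
End HahnBanach.

Section ComplexHahnBanach.
Local Open Scope complex_scope.
Context {R : realType}.
Variable E : normedModType R[i].
Implicit Types x y : E.

Lemma unimodular_rotation (a : R[i]) : exists2 c : R[i],
  rnorm (c : R[i]^o) = 1 & c * a = (rnorm (a : R[i]^o))%:C.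
Proof.
have [->|a0] := eqVneq a 0; first by exists 1; rewrite ?rnorm1// mulr0 rnorm0.
have na0 : `|a| != 0 by rewrite normr_eq0.
exists (`|a| / a); last by rewrite divfK// normr_rnorm.
by rewrite /rnorm normrM normfV normr_id divff.
Qed.

(** The prescribed values are given by the graph [Phi] of a functional on a
    subspace, its domination making it single valued.  The functional is
    recovered from its real part [g] as [g x - i g (i x)], and a rotation of
    [x] transfers the bound of [g] to it. *)
Theorem hahn_banach (Phi : E -> R[i] -> Prop) (K : R) :
  0 <= K -> Phi 0 0 ->
  (forall (a : R[i]) x y s t, Phi x s -> Phi y t ->
     Phi (a *: x + y) (a * s + t)) ->
  (forall x s, Phi x s -> rnorm (s : R[i]^o) <= K * rnorm x) ->
  exists g : {linear E -> R[i]^o},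
    (forall x s, Phi x s -> g x = s) /\ forall x, rnorm (g x) <= K * rnorm x.
Proof.
move=> K0 Phi0 PhiL PhiK.
have PhiZ a x s : Phi x s -> Phi (a *: x) (a * s).
  by move=> Px; have := PhiL a _ _ _ _ Px Phi0; rewrite !addr0.
have [|||||g [gD gZ gK gC]] := @real_hahn_banach R E (fun x => K * rnorm x)
  (fun y r => exists2 s, Phi y s & r = complex.Re s).
- split=> [x y|t x t0]; first by rewrite -mulrDr ler_wpM2l ?rnormD.
  by rewrite rnormZ rnorm_real ger0_norm// mulrCA.
- by exists 0.
- move=> y _ [s Ps ->]; exact: le_trans (Re_le_rnorm _) (PhiK _ _ Ps).
- move=> y z _ _ [s Ps ->] [t Pt ->]; exists (s + t); last by rewrite raddfD.
  by have := PhiL 1 _ _ _ _ Ps Pt; rewrite scale1r mul1r.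
- move=> t y _ t0 [s Ps ->]; exists (t%:C * s); first exact: PhiZ.
  by case: s {Ps} => a b /=; rewrite mul0r subr0.
have gN x : g (- x) = - g x by have := gZ (-1) x; rewrite rmorphN scaleN1r mulN1r.
have gRe x s : Phi x s -> g x = complex.Re s.
  move=> Ps; apply/le_anti; rewrite gC; last by exists s.
  rewrite andbT -[_ <= _]lerN2 -gN -raddfN; apply: gC; exists (- s) => //.
  by have := PhiZ (-1) _ _ Ps; rewrite scaleN1r mulN1r.
pose G x : R[i]^o := g x +i* - g ('i *: x).
have GL : linear G.
  move=> a x y.
  have aE : a = (complex.Re a)%:C + 'i * (complex.Im a)%:C by exact: complexE.
  have ga z : g (a *: z) = complex.Re a * g z + complex.Im a * g ('i *: z).
    by rewrite {1}aE scalerDl gD (mulrC 'i) -scalerA !gZ.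
  apply/eqP; rewrite eq_complex /G /= !scalerDr !gD ga.
  rewrite scalerA (mulrC 'i) -scalerA ga scalerA -expr2 sqr_i scaleN1r gN.
  by case: a {ga aE} => u v /=; apply/andP; split; apply/eqP; ring.
pose GG : {linear E -> R[i]^o} := HB.pack G (GRing.isLinear.Build _ _ _ _ G GL).
exists GG; split=> [x s Ps|x] /=.
  apply/eqP; rewrite eq_complex /G /= (gRe _ _ Ps) (gRe _ _ (PhiZ 'i _ _ Ps)).
  by rewrite eqxx; case: s {Ps} => a b /=; rewrite mul0r mul1r add0r opprK.
have [c c1 cG] := unimodular_rotation (G x).
have : complex.Re (G (c *: x)) <= K * rnorm x.
  by apply: le_trans (gK _) _; rewrite rnormZ c1 mul1r.
by rewrite -[G]/(GG : E -> _) linearZ /= -[_ *: _]/(c * G x) cG.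
Qed.

Lemma norming_functional x : exists g : {linear E -> R[i]^o},
  g x = (rnorm x)%:C /\ forall y, rnorm (g y) <= rnorm y.
Proof.
have [|||g [gx g1]] := @hahn_banach
    (fun y s => exists a, y = a *: x /\ s = a * (rnorm x)%:C) 1 ler01.
- by exists 0; rewrite scale0r mul0r.
- move=> a _ _ _ _ [b [-> ->]] [c [-> ->]]; exists (a * b + c).
  by rewrite scalerDl scalerA mulrDl mulrA.
- move=> _ _ [a [-> ->]].
  by rewrite mul1r rnormM rnormZ rnorm_real ger0_norm// rnorm_ge0.
exists g; split=> [|y]; last by rewrite -[leRHS]mul1r.
by apply: gx; exists 1; rewrite scale1r mul1r.
Qed.
End ComplexHahnBanach.

(** * Isomorphic copies of the space of null sequences *)

Section BoundedLinearMaps.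
Local Open Scope complex_scope.
Context {R : realType} {V W : normedModType R[i]}.

Lemma rbounded_continuous (f : {linear V -> W}) (L : R) :
  0 <= L -> (forall u, rnorm (f u) <= L * rnorm u) -> continuous f.
Proof.
move=> L0 fL u; apply/cvgrPdist_lt => _ /gt0_complex[e e0 ->].
have L1 : 0 < L + 1 by lra.
apply/nbhs_ballP; exists (e / (L + 1))%:C => [|v].
  by rewrite /= (@ltcR R 0) divr_gt0.
rewrite -ball_normE /= !norm_ltE -linearB ltr_pdivlMr// mulrC => uv.
apply: le_lt_trans (fL _) (le_lt_trans _ uv).
by rewrite ler_wpM2r ?rnorm_ge0//; lra.
Qed.

Lemma continuous_at0 (f : {linear V -> W}) : continuous f ->
  exists2 d : R, 0 < d & forall u, rnorm u < d -> rnorm (f u) < 1.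
Proof.
move=> cf; have ltr01C : 0 < (1 : R)%:C by rewrite (@ltcR R 0).
have /cvgrPdist_lt/(_ _ ltr01C)/nbhs_ballP[_ /= /gt0_complex[d d0 ->] df] := cf 0.
exists d => // u ud; have := df u; rewrite -ball_normE /= linear0 !sub0r !normrN.
by rewrite !norm_ltE; exact.
Qed.

Lemma inverse_continuous (f : {linear V -> W}) (g : W -> V) (K : R) :
  0 <= K -> (forall u, rnorm u <= K * rnorm (f u)) -> cancel f g ->
  {within range f, continuous g}.
Proof.
move=> K0 fK fg.
suff gf u y : y = u -> g @ within (range f) (nbhs (f u)) --> y.
  by apply/subspace_continuousP => _ [u _ <-]; exact: gf (fg u).
move=> ->; apply/cvgrPdist_lt => _ /gt0_complex[e e0 ->].
have K1 : 0 < K + 1 by lra.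
rewrite near_withinE; apply/nbhs_ballP.
exists (e / (K + 1))%:C => [|z]; first by rewrite /= (@ltcR R 0) divr_gt0.
rewrite -ball_normE /= !norm_ltE => + [v _ vz].
rewrite -{}vz => uv; rewrite fg; move: uv; rewrite -linearB ltr_pdivlMr// mulrC => uv.
apply: le_lt_trans (fK _) (le_lt_trans _ uv).
by rewrite ler_wpM2r ?rnorm_ge0//; lra.
Qed.

Lemma inverse_continuous_at0 (f : {linear V -> W}) (g : W -> V) :
  cancel f g -> {within range f, continuous g} ->
  exists2 d : R, 0 < d & forall u, rnorm (f u) < d -> rnorm u < 1.
Proof.
move=> fg cg; have ltr01C : 0 < (1 : R)%:C by rewrite (@ltcR R 0).
have : g @ within (range f) (nbhs (f 0)) --> g (f 0).
  by move/subspace_continuousP: cg; apply; exists 0.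
rewrite fg linear0 => /cvgrPdist_lt/(_ _ ltr01C).
rewrite near_withinE => /nbhs_ballP[_ /= /gt0_complex[d d0 ->] dg].
exists d => // u ud; have := dg (f u).
rewrite -ball_normE /= fg !sub0r !normrN !norm_ltE; apply => //.
by exists u.
Qed.
End BoundedLinearMaps.

Section CopiesOfC0.
Local Open Scope complex_scope.
Context {R : realType}.

Lemma rnorm_c0_le (u : c0 R) (M : R) :
  (forall n, rnorm (u n) <= M) -> rnorm u <= M.
Proof. by move=> uM; rewrite -(@lecR R) -rnormE; exact: c0_norm_le. Qed.

Lemma rnorm_c0_ge (u : c0 R) n : rnorm (u n) <= rnorm u.
Proof. by rewrite -(@lecR R) -[leRHS]rnormE; exact: rnorm_le_c0_norm. Qed.

Lemma null_seq_rP (u : nat -> R[i]^o) :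
  (forall e : R, 0 < e -> exists N, forall n, (N <= n)%N -> rnorm (u n) < e) <->
  u \in @null_seq R.
Proof.
split=> [u0|/null_seqP/rcvgP u0 e /u0[N uN]]; last first.
  by exists N => n /uN; rewrite subr0.
apply/null_seqP/rcvgP => e /u0[N uN].
by exists N => n /uN; rewrite subr0.
Qed.

(** Continuity at [0], in either direction of an isomorphism, turns into a bound
    by rescaling [x] until [p x = e]. *)
Lemma homogeneous_bound (V : lmodType R[i]) (p q : V -> R) (d e : R) :
  0 < d -> 0 < e -> (forall x, 0 <= q x) ->
  (forall (t : R) x, 0 <= t -> p (t%:C *: x) = t * p x) ->
  (forall (t : R) x, 0 <= t -> q (t%:C *: x) = t * q x) ->
  (forall x, q x < d -> p x < e) -> forall x, p x <= e / d * q x.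
Proof.
move=> d0 e0 q0 pZ qZ qp x; rewrite leNgt; apply/negP => px.
have px0 : 0 < p x.
  by apply: le_lt_trans px; rewrite mulr_ge0// divr_ge0 ?ltW//.
have t0 : 0 <= e / p x by rewrite divr_ge0// ltW.
have qxd : e / p x * q x < d.
  by move: px; rewrite [in e / d * _]mulrAC [in e / p x * _]mulrAC
    !ltr_pdivrMr// (mulrC d).
have := qp ((e / p x)%:C *: x); rewrite pZ// qZ// divfK ?gt_eqF//.
by rewrite ltxx => /(_ qxd).
Qed.

Context {E : normedModType R[i]}.

(** On the copy the coordinates are functionals bounded by [K], which extend to
    the whole space by the Hahn-Banach theorem. *)
Lemma extended_coordinates (J : {linear c0 R -> E}) (K : R) :
  0 <= K -> (forall u, rnorm u <= K * rnorm (J u)) ->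
  exists f : nat -> {linear E -> R[i]^o},
    (forall n u, f n (J u) = u n) /\ forall n x, rnorm (f n x) <= K * rnorm x.
Proof.
move=> K0 JK.
suff /choice[f fP] : forall n, exists g : {linear E -> R[i]^o},
    (forall u, g (J u) = u n) /\ forall x, rnorm (g x) <= K * rnorm x.
  by exists f; split=> n; case: (fP n).
move=> n; have [|||g [gJ gK]] :=
  @hahn_banach R E (fun y s => exists u : c0 R, y = J u /\ s = u n) K K0.
- by exists 0; rewrite linear0.
- move=> a _ _ _ _ [u [-> ->]] [v [-> ->]].
  by exists (a *: u + v); rewrite linearP.
- move=> _ _ [u [-> ->]]; exact: le_trans (rnorm_c0_ge u n) (JK u).
by exists g; split=> // u; apply: gJ; exists u.
Qed.

(** The range is closed because the extended coordinate functionals identify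
    the limits of its points: evaluated at such a limit they give a null
    sequence, uniformly close to the sequences approximating it. *)
Lemma contains_copy_intro (J : {linear c0 R -> E}) (L K : R) :
  0 <= L -> 0 <= K -> (forall u, rnorm (J u) <= L * rnorm u) ->
  (forall u, rnorm u <= K * rnorm (J u)) -> contains_copy_of_c0 E.
Proof.
move=> L0 K0 JL JK; have [f [fJ fK]] := extended_coordinates K0 JK.
have Jinj : injective J.
  move=> u v Juv; apply/eqP; rewrite -subr_eq0; apply/eqP/rnorm0_eq0/le_anti.
  by have := JK (u - v); rewrite linearB Juv subrr rnorm0 mulr0 rnorm_ge0 => ->.
exists J; split.
- exact: rbounded_continuous L0 JL.
- move=> y /rclosureP yJ.
  have fyJ (u : c0 R) n : rnorm (f n y - u n) <= K * rnorm (y - J u).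
    by rewrite -(fJ n u) -linearB.
  have v0 : (fun n => f n y) \in @null_seq R.
    apply/null_seq_rP => e e0.
    have K1 : 0 < K + 1 by lra.
    have d0 : 0 < e / 2 / (K + 1) by apply: divr_gt0 => //; lra.
    have [_ [u _ <-] yu] := yJ _ d0.
    have /null_seq_rP/(_ (e / 2))[|N uN] := c0_valP u; first by lra.
    exists N => n /uN un; have := rnormD (f n y - u n) (u n); rewrite subrK.
    have := fyJ u n; move: yu; rewrite ltr_pdivlMr//.
    have := rnorm_ge0 (y - J u); nra.
  exists (C0 v0) => //; apply/eqP; rewrite -subr_eq0.
  apply/eqP/rnorm0_eq0/le_anti; rewrite rnorm_ge0 andbT.
  apply/ler_addgt0Pr => e e0; rewrite add0r.
  have KL1 : 0 < L * K + 1 by rewrite ltr_wpDl// mulr_ge0.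
  have d0 : 0 < e / (L * K + 1) by exact: divr_gt0.
  have [_ [u _ <-] yu] := yJ _ d0.
  apply: (le_trans (rnorm_distD (J u) _ _)).
  rewrite -linearB (rnormBC (J u)).
  have : rnorm (C0 v0 - u) <= K * rnorm (y - J u).
    by apply: rnorm_c0_le => n; exact: fyJ.
  move: yu; rewrite ltr_pdivlMr// => yu vu.
  have := ler_wpM2l L0 vu; have := JL (C0 v0 - u).
  have := rnorm_ge0 (y - J u); nra.
have GJ : cancel J (fun y => xget 0 [set u | J u = y]).
  by move=> u; case: xgetP => [v _ /Jinj->//|/(_ u)/(_ erefl)].
by exists (fun y => xget 0 [set u | J u = y]) => //; exact: inverse_continuous K0 JK GJ.
Qed.

Lemma contains_copy_elim : contains_copy_of_c0 E ->
  exists (J : {linear c0 R -> E}) (L K : R), [/\ 0 <= L, 0 <= K,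
    forall u, rnorm (J u) <= L * rnorm u &
    forall u, rnorm u <= K * rnorm (J u)].
Proof.
move=> [J [cJ _ [G JG cG]]]; exists J.
have rnormZp (V : normedModType R[i]) (t : R) (x : V) :
  0 <= t -> rnorm (t%:C *: x) = t * rnorm x.
  by move=> t0; rewrite rnormZ rnorm_real ger0_norm.
have [L L0 JL] : exists2 L : R, 0 <= L & forall u, rnorm (J u) <= L * rnorm u.
  have [d d0 dJ] := continuous_at0 cJ; exists (1 / d).
    by rewrite divr_ge0 ?ltW.
  apply: homogeneous_bound => //.
  - by move=> x; exact: rnorm_ge0.
  - by move=> t x t0; rewrite linearZ rnormZp.
  - by move=> t x t0; rewrite rnormZp.
have [K K0 JK] : exists2 K : R, 0 <= K & forall u, rnorm u <= K * rnorm (J u).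
  have [d d0 dG] := inverse_continuous_at0 JG cG; exists (1 / d).
    by rewrite divr_ge0 ?ltW.
  apply: (homogeneous_bound (p := fun u : c0 R => rnorm u)
    (q := fun u => rnorm (J u)) d0 ltr01) => //.
  - by move=> x; exact: rnorm_ge0.
  - by move=> t x t0; rewrite rnormZp.
  - by move=> t x t0; rewrite linearZ rnormZp.
by exists L, K.
Qed.
End CopiesOfC0.

(** * Series with bounded subset sums *)

Section Rosenthal.
Context {R : realType}.

(** Rosenthal's disjointness lemma.  Cut the indices into infinitely many
    infinite classes (by a pairing function).  If no class has all its
    off-diagonal row sums below [eps], pick in every class a row exceeding it:
    on the set of picked indices the row sums have lost [eps], because a picked
    row already spends [eps] inside its own class, which contains no other
    picked index. *)
Lemma rosenthal (eps : R) (j : nat) (a : nat -> nat -> R) :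
  0 <= eps ->
  (forall n s, uniq s -> \sum_(m <- s) a n m <= eps *+ j) ->
  exists2 g : nat -> nat, injective g &
    forall n s, uniq s -> n \notin s -> \sum_(m <- s) a (g n) (g m) <= eps.
Proof.
move=> eps0; elim: j a => [|j IHj] a aj.
  exists id => // n s us _; apply: (le_trans (aj n s us)).
  by rewrite mulr0n.
pose t (p k : nat) : nat := pickle (p, k).
have tI p k q l : t p k = t q l -> p = q /\ k = l.
  by move=> /(pcan_inj pickleK)[-> ->].
have [[p tp]|nt] := pselect (exists p, forall n s, uniq s -> n \notin s ->
    \sum_(m <- s) a (t p n) (t p m) <= eps).
  by exists (t p) => // k l /tI[].
have /choice[w wP] : forall p, exists w : nat * seq nat,
    [/\ uniq w.2, w.1 \notin w.2 & eps < \sum_(m <- w.2) a (t p w.1) (t p m)].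
  move=> p; apply: contrapT => Np; apply: nt; exists p => n s us ns.
  by rewrite leNgt; apply/negP => lt; apply: Np; exists (n, s).
pose k p := t p (w p).1.
have kI : injective k by move=> p q /tI[].
have [|g gI gP] := IHj (fun p q => a (k p) (k q)); last first.
  by exists (k \o g) => //; exact: inj_comp.
move=> p s us; have [uw nw lt_eps] := wP p.
have uks : uniq ([seq k q | q <- s] ++ [seq t p m | m <- (w p).2]).
  rewrite cat_uniq !map_inj_uniq// ?us ?uw ?andbT/=; last by move=> ? ? /tI[].
  apply/hasPn => _ /mapP[m mw ->]; apply/mapP => -[q _ /tI[pq mwq]].
  by move: nw; rewrite {1}pq -mwq mw.
have := aj (k p) _ uks; rewrite big_cat !big_map mulrSr/=.
by move: lt_eps; rewrite -/(k p); lra.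
Qed.
End Rosenthal.

Section BoundedSubsetSums.
Local Open Scope complex_scope.
Context {R : realType} {E : normedModType R[i]}.
Variables (x : nat -> E) (C : R).
Hypothesis xC : forall s, uniq s -> rnorm (\sum_(i <- s) x i) <= C.

Lemma subset_sums_ge0 : 0 <= C.
Proof. by have := xC (s := [::]) isT; rewrite big_nil rnorm0. Qed.

(** A sum with coefficients in the unit interval is a convex combination of
    subset sums, one coordinate being treated at a time. *)
Lemma convex_sum_le (c : nat -> R) (s : seq nat) (b : E) :
  (forall i, i \in s -> 0 <= c i <= 1) ->
  (forall s', subseq s' s -> rnorm (b + \sum_(i <- s') x i) <= C) ->
  rnorm (b + \sum_(i <- s) (c i)%:C *: x i) <= C.
Proof.
elim: s b => [|i s IHs] b c01 bC.
  by have := bC [::] isT; rewrite !big_nil.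
rewrite big_cons addrA; apply: IHs => [k ks|s' ss'].
  by apply: c01; rewrite inE ks orbT.
have /andP[ci0 ci1] := c01 i (mem_head _ _).
have h0 : rnorm (b + \sum_(k <- s') x k) <= C.
  by apply: bC; apply: subseq_trans ss' _; exact: subseq_cons.
have h1 : rnorm (b + \sum_(k <- i :: s') x k) <= C by apply: bC; rewrite /= eqxx.
have -> : b + (c i)%:C *: x i + \sum_(k <- s') x k =
    (1 - c i)%:C *: (b + \sum_(k <- s') x k) +
    (c i)%:C *: (b + \sum_(k <- i :: s') x k).
  rewrite big_cons [b + (x i + _)]addrCA (scalerDr _ (x i)) addrCA -scalerDl.
  by rewrite -rmorphD/= subrK scale1r addrCA addrA.
apply: (le_trans (rnormD _ _)); rewrite !rnormZ !rnorm_real !ger0_norm ?subr_ge0//.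
by nra.
Qed.

Lemma nonneg_sum_le (c : nat -> R) (B : R) (s : seq nat) : uniq s -> 0 <= B ->
  (forall i, i \in s -> 0 <= c i <= B) ->
  rnorm (\sum_(i <- s) (c i)%:C *: x i) <= B * C.
Proof.
move=> us; rewrite le_eqVlt => /predU1P[<-|B0] cB.
  rewrite big1_seq ?rnorm0 ?mul0r// => i /andP[_ /cB].
  by move=> /le_anti <-; rewrite scale0r.
have -> : \sum_(i <- s) (c i)%:C *: x i =
    B%:C *: (0 + \sum_(i <- s) (c i / B)%:C *: x i).
  rewrite add0r scaler_sumr; apply: eq_bigr => i _.
  by rewrite scalerA -rmorphM/= mulrC divfK// gt_eqF.
rewrite rnormZ rnorm_real gtr0_norm// ler_wpM2l ?(ltW B0)//.
apply: convex_sum_le => [i /cB/andP[c0 cB']|s' ss'].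
  by rewrite divr_ge0 ?(ltW B0)//= ler_pdivrMr// mul1r.
by rewrite add0r; apply: xC; exact: subseq_uniq us.
Qed.

Lemma real_sum_le (c : nat -> R) (B : R) (s : seq nat) : uniq s -> 0 <= B ->
  (forall i, i \in s -> `|c i| <= B) ->
  rnorm (\sum_(i <- s) (c i)%:C *: x i) <= 2 * B * C.
Proof.
move=> us B0 cB.
have -> : \sum_(i <- s) (c i)%:C *: x i =
    \sum_(i <- s) ((`|c i| + c i) / 2)%:C *: x i -
    \sum_(i <- s) ((`|c i| - c i) / 2)%:C *: x i.
  rewrite -sumrB; apply: eq_bigr => i _; rewrite -scalerBl -rmorphB/=.
  by congr (_%:C *: _); field.
have cB' i : i \in s -> - `|c i| <= c i <= `|c i| /\ `|c i| <= B.
  by move=> /cB ?; rewrite -ler_norml.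
apply: (le_trans (rnormB _ _)); rewrite -mulrA mulrDl mul1r.
by apply: lerD; apply: nonneg_sum_le => // i /cB'; lra.
Qed.

Lemma complex_sum_le (c : nat -> R[i]) (B : R) (s : seq nat) : uniq s -> 0 <= B ->
  (forall i, i \in s -> rnorm (c i : R[i]^o) <= B) ->
  rnorm (\sum_(i <- s) c i *: x i) <= 4 * B * C.
Proof.
move=> us B0 cB.
have -> : \sum_(i <- s) c i *: x i =
    \sum_(i <- s) (complex.Re (c i))%:C *: x i +
    'i *: \sum_(i <- s) (complex.Im (c i))%:C *: x i.
  rewrite scaler_sumr -big_split; apply: eq_bigr => i _ /=.
  by rewrite scalerA -scalerDl -complexE.
apply: (le_trans (rnormD _ _)); rewrite rnormZ rnorm_i mul1r.
have -> : 4 * B * C = 2 * B * C + 2 * B * C by ring.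
by apply: lerD; apply: real_sum_le => // i /cB; apply: le_trans;
  [exact: normr_Re_le|exact: normr_Im_le].
Qed.
End BoundedSubsetSums.

Section BessagaPelczynski.
Local Open Scope complex_scope.
Context {R : realType} {E : completeNormedModType R[i]}.

(** The map [u |-> sum_k u_k x_(g k)] is bounded because the subset sums are.
    For the lower estimate let [f n] norm [x n]; along a sequence [g] provided
    by Rosenthal's lemma for the matrix [|f n (x m)|], the functional [f (g n)]
    sees the coordinate [u n] up to half of the norm of [u]. *)
Theorem bessaga_pelczynski (x : nat -> E) (C d : R) :
  (forall s, uniq s -> rnorm (\sum_(i <- s) x i) <= C) ->
  0 < d -> (forall n, d <= rnorm (x n)) -> contains_copy_of_c0 E.
Proof.
move=> xC d0 xd; have C0 := subset_sums_ge0 xC.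
have /choice[f fP] : forall n, exists g : {linear E -> R[i]^o},
    g (x n) = (rnorm (x n))%:C /\ forall y, rnorm (g y) <= rnorm y.
  by move=> n; exact: norming_functional.
have f1 n y : rnorm (f n y) <= rnorm y by case: (fP n).
have rows n s : uniq s -> \sum_(m <- s) rnorm (f n (x m)) <= 4 * C.
  move=> us; have /choice[c cP] : forall m, exists c : R[i],
      rnorm (c : R[i]^o) = 1 /\ c * f n (x m) = (rnorm (f n (x m)))%:C.
    by move=> m; have [c] := unimodular_rotation (f n (x m)); exists c.
  have : rnorm (\sum_(m <- s) c m *: x m) <= 4 * 1 * C.
    by apply: complex_sum_le => // m _; case: (cP m) => ->.
  rewrite mulr1; apply: le_trans; apply: le_trans (f1 n _).
  rewrite linear_sum.
  have -> : \sum_(m <- s) f n (c m *: x m) = (\sum_(m <- s) rnorm (f n (x m)))%:C.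
    rewrite rmorph_sum; apply: eq_bigr => m _.
    by rewrite linearZ; case: (cP m).
  by rewrite rnorm_real ler_norm.
have e0 : 0 < d / 2 by lra.
have [j Cj] : exists j, 4 * C <= d / 2 *+ j.
  exists (Num.bound (4 * C / (d / 2))); rewrite -[leRHS]mulr_natl -ler_pdivrMr//.
  by apply/ltW/archi_boundP; rewrite divr_ge0 ?(ltW e0)// mulr_ge0.
have [|g gI gP] := @rosenthal R _ j (fun n m => rnorm (f n (x m))) (ltW e0).
  by move=> n s us; apply: le_trans Cj; exact: rows.
pose y k := x (g k).
have yC s : uniq s -> rnorm (\sum_(i <- s) y i) <= C.
  by move=> us; rewrite -(big_map g xpredT); apply: xC; rewrite map_inj_uniq.
pose S (u : c0 R) n := \sum_(k <- iota 0 n) u k *: y k.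
have /choice[J SJ] : forall u, exists l : E, S u n @[n --> \oo] --> l.
  move=> u; apply: rcvg_cauchy => e e0'.
  have C1 : 0 < 4 * C + 1 by lra.
  have := c0_valP u => /null_seq_rP/(_ _ (divr_gt0 e0' C1))[N uN].
  exists N => n Nn.
  have -> : S u n - S u N = \sum_(k <- iota N (n - N)) u k *: y k.
    rewrite /S -{1}(subnKC Nn) iotaD big_cat /= add0n addrAC subrr add0r.
    by [].
  have : e / (4 * C + 1) * (4 * C + 1) = e by rewrite divfK// gt_eqF.
  have : 0 < e / (4 * C + 1) by exact: divr_gt0.
  move: uN; set r := e / _ => uN r0 re.
  apply: (@le_lt_trans _ _ (4 * r * C)); last by lra.
  apply: complex_sum_le (iota_uniq _ _) (ltW r0) _ => // k.
  by rewrite mem_iota => /andP[/uN/ltW].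
have JL : linear J.
  move=> a u v; apply: (@cvg_unique _ (@norm_hausdorff _ E) _ _ _ _ (SJ _)).
  have -> : S (a *: u + v) = (fun n => a *: S u n + S v n).
    apply/funext => n; rewrite /S scaler_sumr -big_split; apply: eq_bigr => k _.
    by rewrite /= scalerDl scalerA.
  by apply: cvgD (SJ v); apply: cvgZl_tmp; exact: SJ.
pose JJ : {linear c0 R -> E} := HB.pack J (GRing.isLinear.Build _ _ _ _ J JL).
have Jle (u : c0 R) : rnorm (JJ u) <= 4 * C * rnorm u.
  apply: (@rcvg_rnorm_le _ _ _ _ _ 0 (SJ u)) => n _; rewrite mulrAC.
  by apply: complex_sum_le (iota_uniq _ _) (rnorm_ge0 _) _ => // k _; exact: rnorm_c0_ge.
have Jge (u : c0 R) n : d * rnorm (u n) - d / 2 * rnorm u <= rnorm (JJ u).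
  apply: (@rcvg_rnorm_ge _ _ _ _ _ n.+1 (SJ u)) => m nm.
  apply: le_trans (f1 (g n) _).
  have mn : n \in iota 0 m by rewrite mem_iota.
  rewrite /S linear_sum (bigD1_seq n)//= ?iota_uniq// -big_filter.
  apply: le_trans (rnorm_addB _ _); apply: lerB.
    rewrite linearZ rnormM mulrC ler_wpM2l ?rnorm_ge0//.
    by case: (fP (g n)) => -> _; rewrite rnorm_real (le_trans (xd (g n)) (ler_norm _)).
  apply: (le_trans (rnorm_sum _ _ _)).
  apply: (@le_trans _ _
    (rnorm u * \sum_(i <- [seq i <- iota 0 m | i != n]) rnorm (f (g n) (y i)))).
    rewrite mulr_sumr; apply: ler_sum => i _; rewrite linearZ rnormM.
    by rewrite ler_wpM2r ?rnorm_ge0// rnorm_c0_ge.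
  rewrite mulrC ler_wpM2r ?rnorm_ge0//; apply: gP.
    by rewrite filter_uniq// iota_uniq.
  by rewrite mem_filter eqxx.
apply: (@contains_copy_intro _ _ JJ (4 * C) (2 / d)) => //.
- by rewrite mulr_ge0.
- by rewrite divr_ge0 ?ltW.
move=> u; have : rnorm u <= (rnorm (JJ u) + d / 2 * rnorm u) / d.
  apply: rnorm_c0_le => n; rewrite ler_pdivlMr// mulrC.
  by have := Jge u n; lra.
rewrite ler_pdivlMr// => h; rewrite mulrAC ler_pdivlMr//; lra.
Qed.
End BessagaPelczynski.

(** * Recurrence and bounded cocycles *)

Section Subsequences.
Context {R : realType} {E : normedModType R[i]}.

Lemma increasing_subsequence (P : nat -> nat -> Prop) :
  (forall N, exists n, (N < n)%N /\ P N n) ->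
  exists b : nat -> nat, {homo b : m n / (m < n)%N} /\
    forall k, P (b k) (b k.+1).
Proof.
move=> /choice[g gP]; exists (fun k => iter k g 0%N); split.
  by apply: homo_ltn => [x y z|k]; [exact: ltn_trans|case: (gP (iter k g 0%N))].
by move=> k; case: (gP (iter k g 0%N)).
Qed.

(** By the pigeonhole principle one of the finitely many balls of radius [e / 2]
    covering [A] is visited infinitely often. *)
Lemma totally_bounded_subsequence (A : set E) (u : nat -> E) (e : R) :
  totally_bounded A -> (forall n, A (u n)) -> 0 < e ->
  exists b : nat -> nat, {homo b : m n / (m < n)%N} /\
    forall j k, rnorm (u (b j) - u (b k)) < e.
Proof.
move=> tA Au e0; have e2 : 0 < e / 2 by lra.
have [s sA] := tA _ e2.
have [y yP] : exists y, forall N, exists n, (N <= n)%N /\ rnorm (u n - y) < e / 2.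
  apply: contrapT => nex.
  have /choice[N NP] : forall y, exists N, forall n, (N <= n)%N ->
      ~ rnorm (u n - y) < e / 2.
    move=> y; apply: contrapT => nN; apply: nex; exists y => N.
    apply: contrapT => nn; apply: nN; exists N => n Nn un.
    by apply: nn; exists n.
  have [y ys] := sA _ (Au (\max_(y <- s) N y)%N).
  by apply: NP; exact: leq_bigmax_seq.
have [|b [bi bP]] := @increasing_subsequence
  (fun _ n => rnorm (u n - y) < e / 2).
  by move=> N; have [n [Nn un]] := yP N.+1; exists n.
exists (b \o S); split=> [m n mn|j k]; first exact: bi.
by have := rnorm_distD y (u (b j.+1)) (u (b k.+1)); rewrite (rnormBC y);
  have := bP j; have := bP k; rewrite /=; lra.
Qed.

(** Greedy choice of a separated sequence: the first values of [f] never form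
    a net of the range. *)
Lemma separated_subsequence (f : nat -> E) : ~ totally_bounded (range f) ->
  exists (d : R) (a : nat -> nat), [/\ 0 < d, {homo a : m n / (m < n)%N} &
    forall j k, (j < k)%N -> d <= rnorm (f (a k) - f (a j))].
Proof.
move=> nt; have [d [d0 dP]] : exists d : R, 0 < d /\ forall s : seq E,
    exists n, forall y, y \in s -> d <= rnorm (f n - y).
  apply: contrapT => nd; apply: nt => e e0; apply: contrapT => ns.
  apply: nd; exists e; split=> // s; apply: contrapT => nn; apply: ns; exists s.
  move=> _ [n _ <-]; apply: contrapT => ny; apply: nn; exists n => y ys.
  by rewrite leNgt; apply/negP => lt; apply: ny; exists y.
have [|a [ai aP]] := @increasing_subsequence
  (fun N n => forall i, (i <= N)%N -> d <= rnorm (f n - f i)).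
  move=> N; have [n nP] := dP [seq f i | i <- iota 0 N.+1].
  have {}nP i : (i <= N)%N -> d <= rnorm (f n - f i).
    by move=> iN; apply: nP; apply: map_f; rewrite mem_iota.
  exists n; split=> //; rewrite ltnNge; apply/negP => /nP.
  by rewrite subrr rnorm0 leNgt d0.
exists d, a; split=> // j [//|k]; rewrite ltnS => jk; apply: aP.
by move: jk; rewrite leq_eqVlt => /predU1P[->//|/ai/ltnW].
Qed.
End Subsequences.

Section Recurrence.
Local Open Scope complex_scope.
Context {R : realType} {E : normedModType R[i]}.
Variables (T : {linear E -> E}) (M : R).
Hypothesis TM : forall n z, rnorm (iter n T z) <= M * rnorm z.

Lemma iter_linearP n (a : R[i]) x y :
  iter n T (a *: x + y) = a *: iter n T x + iter n T y.
Proof. by elim: n => //= n ->; rewrite linearP. Qed.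

Lemma iterB_linear n x y : iter n T (x - y) = iter n T x - iter n T y.
Proof.
by rewrite addrC -scaleN1r iter_linearP scaleN1r addrC.
Qed.

Lemma iter_eigen n (lambda : R[i]) x : T x = lambda *: x ->
  iter n T x = lambda ^+ n *: x.
Proof.
move=> Tx; elim: n => [|n IHn]; first by rewrite scale1r.
by rewrite /= IHn linearZ /= Tx scalerA -exprSr.
Qed.

(** Every sequence of times has a subsequence whose time differences nearly fix
    the vector.  Quantifying over all sequences lets finitely many vectors be
    treated at once, by successive extraction. *)
Definition recurrent x := forall (e : R) (a : nat -> nat), 0 < e ->
  {homo a : m n / (m < n)%N} ->
  exists b : nat -> nat, {homo b : m n / (m < n)%N} /\
    forall j k, (j < k)%N -> rnorm (iter (a (b k) - a (b j)) T x - x) < e.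

(** On an eigenvector with unimodular eigenvalue [iter n T] is isometric, so
    closeness of two points of its orbit only depends on the difference of their
    times. *)
Lemma recurrent_eigen (lambda : R[i]) x :
  aap T x -> `|lambda| = 1 -> T x = lambda *: x -> recurrent x.
Proof.
move=> /precompact_totally_bounded tx lambda1 Tx e a e0 ai.
have [n|b [bi bP]] := totally_bounded_subsequence (u := fun n => iter (a n) T x) tx _ e0.
  by exists (a n).
exists b; split=> // j k jk; apply: le_lt_trans (bP k j).
have abjk : (a (b j) <= a (b k))%N by apply/ltnW/ai/bi.
have l1 n : rnorm (lambda ^+ n : R[i]^o) = 1.
  by rewrite rnormX /rnorm lambda1 expr1n.
rewrite !(iter_eigen _ Tx) -[leLHS]mul1r -(l1 (a (b j))) -rnormZ.
by rewrite scalerBr scalerA -exprD subnKC.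
Qed.

Lemma recurrent_seq (s : seq E) (e : R) (a : nat -> nat) :
  (forall x, x \in s -> recurrent x) -> 0 < e -> {homo a : m n / (m < n)%N} ->
  exists b : nat -> nat, {homo b : m n / (m < n)%N} /\
    forall x, x \in s -> forall j k, (j < k)%N ->
      rnorm (iter (a (b k) - a (b j)) T x - x) < e.
Proof.
move=> + e0 ai; elim: s => [_|x s IHs rs]; first by exists id; split.
have [y ys|b [bi bP]] := IHs; first by move: (rs y); rewrite inE ys orbT; apply.
have [m n mn|c [ci cP]] := rs x (mem_head _ _) e (a \o b) e0.
  by apply: ai; exact: bi.
exists (b \o c); split=> [m n mn|y]; first by apply: bi; exact: ci.
rewrite inE => /predU1P[->|ys] j k jk; first exact: cP.
by apply: bP => //; exact: ci.
Qed.

Lemma recurrent_linear (c : R[i]) x y :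
  recurrent x -> recurrent y -> recurrent (c *: x + y).
Proof.
move=> rx ry e a e0 ai; pose K := rnorm (c : R[i]^o) + 1.
have K1 : 1 <= K by rewrite lerDr rnorm_ge0.
have K0 : 0 < K by lra.
have d0 : 0 < e / 2 / K by rewrite divr_gt0//; lra.
have [z|b [bi bP]] := @recurrent_seq [:: x; y] _ a _ d0 ai.
  by rewrite !inE => /orP[]/eqP->.
exists b; split=> // j k jk.
have hx := bP x (mem_head _ _) _ _ jk.
have ys : y \in [:: x; y] by rewrite !inE eqxx orbT.
have hy := bP y ys _ _ jk; rewrite iter_linearP opprD addrACA -scalerBr.
apply: le_lt_trans (rnormD _ _) _; rewrite rnormZ.
move: hx hy; rewrite !ltr_pdivlMr// /K.
set p := rnorm (iter _ T x - x); set q := rnorm (iter _ T y - y).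
have : 0 <= p by exact: rnorm_ge0.
have : 0 <= q by exact: rnorm_ge0.
by have := rnorm_ge0 (c : R[i]^o); nra.
Qed.

Lemma recurrent_closure (A : set E) x :
  (forall y, A y -> recurrent y) -> closure A x -> recurrent x.
Proof.
move=> rA /rclosureP xA e a e0 ai.
have M0 : 0 <= `|M| by [].
have d0 : 0 < e / 3 / (`|M| + 1) by rewrite divr_gt0//; lra.
have [y Ay xy] := xA _ d0.
have e3 : 0 < e / 3 by lra.
have [b [bi bP]] := rA _ Ay _ _ e3 ai; exists b; split=> // j k jk.
have := bP _ _ jk; set m := (_ - _)%N => hy.
have hM : rnorm (iter m T (x - y)) <= `|M| * rnorm (x - y).
  by apply: le_trans (TM _ _) _; rewrite ler_wpM2r ?rnorm_ge0// ler_norm.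
have := rnorm_distD (iter m T y) (iter m T x) x; rewrite -iterB_linear.
have := rnorm_distD y (iter m T y) x; rewrite (rnormBC y).
by move: xy; rewrite ltr_pdivlMr//; have := rnorm_ge0 (x - y); nra.
Qed.

Lemma recurrent_rev_part x : rev_part T x -> recurrent x.
Proof.
apply: recurrent_closure => _ [n [c [v [vP ->]]]].
elim: n c v vP => [|n IHn] c v vP.
  rewrite big_ord0 => e a e0 ai; exists id; split=> // j k jk.
  by have := iterB_linear (a k - a j) 0 0; rewrite !subrr => ->; rewrite subrr rnorm0.
rewrite big_ord_recl; apply: recurrent_linear; last exact: IHn.
by have [av [lambda l1 Tv]] := vP ord0; exact: recurrent_eigen l1 Tv.
Qed.

End Recurrence.

Section Kadets.
Local Open Scope complex_scope.
Context {R : realType} {E : completeNormedModType R[i]}.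
Variables (T : {linear E -> E}) (M : R).
Hypothesis TM : forall n z, rnorm (iter n T z) <= M * rnorm z.

(** A version of Kadets' theorem on bounded integrals of almost periodic
    functions.  If the range of [f] is not totally bounded, the cocycle identity
    turns a separated sequence of values of [f] into arbitrarily many times [m]
    with [f m] bounded away from [0], and by recurrence [m] can be chosen so
    that [iter m T] nearly fixes the value of [f] at every sum of times chosen
    before.  Then [f] is nearly additive on the chosen times, so that subset
    sums of the [f m] are close to values of [f], hence bounded. *)
Theorem kadets (f : nat -> E) (C : R) :
  (forall n m, f (n + m)%N = f n + iter n T (f m)) ->
  (forall n, rnorm (f n) <= C) -> (forall n, recurrent T (f n)) ->
  ~ contains_copy_of_c0 E -> totally_bounded (range f).
Proof.
move=> fD fC fr nc0; apply: contrapT => /separated_subsequence[d [a [d0 ai ad]]].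
apply: nc0.
have f0 : f 0%N = 0.
  by have /eqP := fD 0%N 0%N; rewrite addn0 -subr_eq0 opprD addNKr oppr_eq0 => /eqP.
have M0 : 0 < M.
  rewrite ltNge; apply/negP => M0; have := ad 0%N 1%N isT.
  rewrite leNgt; apply/negP; rewrite negbK; apply: le_lt_trans d0.
  by apply: le_trans (TM 0 _) _; rewrite mulr_le0_ge0// rnorm_ge0.
(* [f (a 1) - f (a 0)] is the image of [f] at the time difference, whose norm is
   therefore at least [d / M] *)
have pick (s : seq E) (e : R) : exists m, (forall x, x \in s -> recurrent T x) ->
    0 < e -> d / M <= rnorm (f m) /\
    forall x, x \in s -> rnorm (iter m T x - x) < e.
  have [[rs e0]|] := pselect ((forall x, x \in s -> recurrent T x) /\ 0 < e); last first.
    by move=> nrs; exists 0%N => rs e0; exfalso; apply: nrs.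
  have [b [bi bP]] := recurrent_seq rs e0 ai.
  exists (a (b 1%N) - a (b 0%N))%N => _ _; split; last by move=> x xs; exact: bP.
  have abP : (a (b 0%N) <= a (b 1%N))%N by apply/ltnW/ai/bi.
  rewrite ler_pdivrMr// mulrC; apply: le_trans (TM (a (b 0%N)) _).
  apply: le_trans (ad _ _ (bi _ _ (ltnSn 0))) _.
  by rewrite -{1}(subnKC abP) fD addrAC subrr add0r.
have /choice[pick1 pickP] : forall se : seq E * R, exists m,
    (forall x, x \in se.1 -> recurrent T x) ->
    0 < se.2 -> d / M <= rnorm (f m) /\
    forall x, x \in se.1 -> rnorm (iter m T x - x) < se.2.
  by move=> [s e]; exact: pick.
(* [sums k] lists the subset sums of the first [k] chosen times *)
pose next k (s : seq nat) := pick1 (map f s, 2 ^- k.+1 : R).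
pose sums := fix sums k := if k is k'.+1 then
  sums k' ++ map (addn (next k' (sums k'))) (sums k') else [:: 0%N].
pose m k := next k (sums k).
have mP k : d / M <= rnorm (f (m k)) /\
    forall n, n \in sums k -> rnorm (iter (m k) T (f n) - f n) < 2 ^- k.+1.
  have [||h1 h2] := pickP (map f (sums k), 2 ^- k.+1 : R).
  - by move=> _ /= /mapP[n _ ->]; exact: fr.
  - by rewrite /= invr_gt0 exprn_gt0.
  by split=> // n ns; apply: h2; exact: map_f.
have near_additive (P : pred nat) k :
    (\sum_(i < k | P i) m i)%N \in sums k /\
    rnorm (f (\sum_(i < k | P i) m i)%N - \sum_(i < k | P i) f (m i)) <= 1 - 2 ^- k.
  elim: k => [|k [IHs IHf]].
    by rewrite !big_ord0 inE f0 !subrr rnorm0 expr0 invr1 subrr.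
  have recP V (idx : V) (op : Monoid.law idx) (F : nat -> V) :
      \big[op/idx]_(i < k.+1 | P i) F i =
      op (\big[op/idx]_(i < k | P i) F i) (if P k then F k else idx).
    by rewrite big_mkcond big_ord_recr -big_mkcond.
  rewrite (recP _ _ _ m) (recP _ _ _ (fun i => f (m i))) /= mem_cat.
  have pow2 : 2 ^- k = 2 * 2 ^- k.+1 :> R.
    by rewrite exprS invfM mulrA mulfV// mul1r.
  have pow0 : 0 < 2 ^- k.+1 :> R by rewrite invr_gt0 exprn_gt0.
  case: (P k); last by rewrite addn0 addr0 IHs; split=> //; lra.
  rewrite addnC map_f ?orbT//; split=> //; rewrite fD.
  have [_ /(_ _ IHs)] := mP k.
  move: IHf; set n := (\sum_(i < k | P i) m i)%N; set y := \sum_(i < k | P i) f (m i).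
  move=> IHf hm; have := rnormD (iter (m k) T (f n) - f n) (f n - y).
  rewrite subrKA; have -> : f (m k) + iter (m k) T (f n) - (y + f (m k)) =
    iter (m k) T (f n) - y by rewrite (addrC y) opprD addrACA subrr add0r.
  by lra.
apply: (@bessaga_pelczynski _ _ (f \o m) (C + 1) (d / M)).
- move=> s us; pose k := (\max_(i <- s) i).+1.
  have -> : \sum_(i <- s) (f \o m) i = \sum_(i < k | (i : nat) \in s) f (m i).
    rewrite -(big_mkord (fun i => i \in s) (fun i => f (m i))) -big_filter.
    apply: perm_big; apply: uniq_perm => //; first by rewrite filter_uniq// iota_uniq.
    move=> i; rewrite mem_filter mem_index_iota /=.
    by case: (boolP (i \in s)) => //= si; rewrite ltnS leq_bigmax_seq.
  have [_] := near_additive (fun i => i \in s) k.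
  set n := (\sum_(i < k | _) _)%N; set y := \sum_(i < k | _) _.
  have := rnormB (f n) (f n - y); rewrite subKr; have := fC n.
  have : 0 < 2 ^- k :> R by rewrite invr_gt0 exprn_gt0.
  by lra.
- exact: divr_gt0.
- by move=> k; case: (mP k).
Qed.
End Kadets.

(** * Orbits of operators on spaces without copies of the null sequences *)

Section Bounds.
Local Open Scope complex_scope.
Context {R : realType} {E : normedModType R[i]}.

(** Stated relative to [D] because a projection onto the reversible part is only
    controlled on the almost periodic vectors. *)
Lemma unit_ball_bound (D : set E) (f : E -> E) (M : R) :
  (forall (a : R[i]) x, D x -> D (a *: x) /\ f (a *: x) = a *: f x) ->
  (forall x, D x -> rnorm x <= 1 -> rnorm (f x) <= M) ->
  forall x, D x -> rnorm (f x) <= M * rnorm x.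
Proof.
move=> fZ fM x Dx; have [x0|x0] := eqVneq (rnorm x) 0.
  rewrite x0 mulr0 -[x]scale1r; have := fZ 0 x Dx.
  by rewrite scale1r (rnorm0_eq0 x0) !scaler0 scale0r => -[_ ->]; rewrite rnorm0.
have {}x0 : 0 < rnorm x by rewrite lt_neqAle eq_sym x0 rnorm_ge0.
have [Dax fax] := fZ (rnorm x)^-1%:C x Dx.
have := fM _ Dax; rewrite fax !rnormZ rnorm_real ger0_norm ?invr_ge0 ?(ltW x0)//.
by rewrite mulVf ?gt_eqF// lexx mulrC ler_pdivrMr// => /(_ isT).
Qed.

Lemma ereal_sup_lty_ub (A : set (\bar R)) : (ereal_sup A < +oo)%E ->
  exists M : R, forall a, A a -> (a <= M%:E)%E.
Proof.
move=> Aoo; have Ale a : A a -> (a <= ereal_sup A)%E by exact: ereal_sup_ubound.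
case: (ereal_sup A) Aoo Ale => [r|//|] _ Ale; first by exists r.
by exists 0 => a /Ale/le_trans; apply; rewrite leNye.
Qed.

Lemma power_bounded_ub (T : {linear E -> E}) : power_bounded T ->
  exists M : R, forall n z, rnorm (iter n T z) <= M * rnorm z.
Proof.
move=> /ereal_sup_lty_ub[M TM]; exists M => n z.
apply: (@unit_ball_bound setT) => // [a x _|x _ x1].
  split=> //; have := iter_linearP T n a x 0; rewrite !addr0.
  suff -> : iter n T 0 = 0 by rewrite addr0.
  by elim: n => //= n ->; rewrite linear0.
rewrite -lee_fin; apply: le_trans (TM _ (ex_intro2 _ _ n I erefl)).
by apply: ereal_sup_ubound; exists x.
Qed.

Lemma power_boundedP (T : {linear E -> E}) (M : R) : 0 <= M ->
  (forall n z, rnorm (iter n T z) <= M * rnorm z) -> power_bounded T.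
Proof.
move=> M0 TM; apply: (@le_lt_trans _ _ M%:E); last exact: ltry.
apply: ge_ereal_sup => _ [n _ <-]; apply: ge_ereal_sup => _ [x [_ x1] <-].
rewrite lee_fin; apply: le_trans (TM _ _) _.
by rewrite -[leRHS]mulr1 ler_wpM2l.
Qed.

Lemma bounded_opP (D : set E) (f : E -> E) (M : R) : 0 <= M ->
  (forall z, D z -> rnorm (f z) <= M * rnorm z) -> bounded_op D f.
Proof.
move=> M0 fM; apply: (@le_lt_trans _ _ M%:E); last exact: ltry.
apply: ge_ereal_sup => _ [x [Dx x1] <-]; rewrite lee_fin.
by apply: le_trans (fM _ Dx) _; rewrite -[leRHS]mulr1 ler_wpM2l.
Qed.
End Bounds.

Section AlmostPeriodicVectors.
Local Open Scope complex_scope.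
Context {R : realType} {E : normedModType R[i]} (T : {linear E -> E}).

Lemma aap_fixed x : T x = x -> aap T x.
Proof.
move=> Tx; apply: precompact_subset (compact_precompact _ (@compact_set1 E x)).
  by move=> _ [n _ <-]; elim: n => //= n ->.
exact: norm_hausdorff.
Qed.

Lemma aap0 : aap T 0.
Proof. by apply: aap_fixed; rewrite linear0. Qed.

Lemma aapZ (a : R[i]) x : aap T x -> aap T (a *: x).
Proof. by move=> ax; rewrite -[_ *: _]addr0; exact: aap_linear aap0. Qed.

Lemma aapD x y : aap T x -> aap T y -> aap T (x + y).
Proof. by move=> ax ay; rewrite -[x]scale1r; exact: aap_linear. Qed.

Lemma aapB x y : aap T x -> aap T y -> aap T (x - y).
Proof. by move=> ax ay; apply: aapD => //; rewrite -scaleN1r; exact: aapZ. Qed.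

Lemma aap_iter n x : aap T x -> aap T (iter n T x).
Proof.
apply: precompact_subset => _ [k _ <-].
by exists (k + n)%N => //; rewrite iterD.
Qed.

Lemma aap_increments x : aap T (T x - x) -> forall n, aap T (iter n T x - x).
Proof.
move=> ax; elim=> [|n IHn]; first by rewrite subrr; exact: aap0.
rewrite iterSr -[_ - x](subrKA (iter n T x)) -iterB_linear.
by apply: aapD => //; exact: aap_iter.
Qed.
End AlmostPeriodicVectors.

Section TotallyBoundedSequences.
Context {R : realType} {E : normedModType R[i]}.

Lemma cvg_totally_bounded (u : nat -> E) (l : E) :
  u n @[n --> \oo] --> l -> totally_bounded (range u).
Proof.
move=> /rcvgP ul e e0; have [N uN] := ul e e0.
exists (l :: [seq u i | i <- iota 0 N]) => _ [n _ <-].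
have [/uN un|nN] := leqP N n; first by exists l => //; exact: mem_head.
exists (u n); last by rewrite subrr rnorm0.
by rewrite inE map_f ?orbT// mem_iota.
Qed.

Lemma totally_boundedD (x : E) (f g : nat -> E) :
  totally_bounded (range f) -> totally_bounded (range g) ->
  totally_bounded (range (fun n => x + (f n + g n))).
Proof.
move=> tf tg e e0; have e2 : 0 < e / 2 by lra.
have [s sf] := tf _ e2; have [t tG] := tg _ e2.
exists [seq x + (a + b) | a <- s, b <- t] => _ [n _ <-].
have [|a as_ fa] := sf (f n); first by exists n.
have [|b bt gb] := tG (g n); first by exists n.
exists (x + (a + b)); first by apply/allpairsP; exists (a, b).
rewrite opprD addrACA subrr add0r opprD addrACA.
by have := rnormD (f n - a) (g n - b); lra.
Qed.
End TotallyBoundedSequences.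

Section OrbitCriterion.
Local Open Scope complex_scope.
Context {R : realType} {E : completeNormedModType R[i]}.
Variables (T : {linear E -> E}) (P : E -> E).
Hypothesis jP : jdlg_projection T P.

Lemma jdlgB x y : aap T x -> aap T y -> P (x - y) = P x - P y.
Proof.
move=> ax ay; have [_ PL _ _] := jP.
by have := PL (-1) y x ay ax; rewrite !scaleN1r addrC => ->; rewrite addrC.
Qed.

Lemma jdlg_iter n x : aap T x -> P (iter n T x) = iter n T (P x).
Proof.
have [_ _ _ [_ PT _ _]] := jP => ax; elim: n => //= n <-.
by rewrite PT//; exact: aap_iter.
Qed.

(** The component [s = x - P x] is stable, and the sequence is
    [iter n T s - s]. *)
Lemma aap_complement_cvg x : aap T x ->
  cvg ((fun n => (iter n T x - x) - P (iter n T x - x)) @ \oo).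
Proof.
move=> ax; have [PA PL _ [PP PT _ Pk]] := jP.
pose s := x - P x.
have [] : stable_part T s.
  rewrite -Pk /=; split; first by apply: aapB => //; exact: PA.
  by rewrite jdlgB ?PP ?subrr//; exact: PA.
move=> as_ s0; apply/cvg_ex; exists (0 - s).
have -> : (fun n => (iter n T x - x) - P (iter n T x - x)) =
    (fun n => iter n T s - s).
  apply/funext => n; rewrite jdlgB//; last exact: aap_iter.
  by rewrite jdlg_iter// /s iterB_linear !opprB addrACA [RHS]addrACA (addrC (- x)).
by apply: cvgB => //; exact: cvg_cst.
Qed.

(** Along [iter n T x - x] the projection [P] is a bounded cocycle with values
    in the reversible part, so Kadets' theorem applies to it; the complementary
    part converges by hypothesis. *)
Lemma aap_of_increments (M : R) x : ~ contains_copy_of_c0 E ->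
  (forall n z, rnorm (iter n T z) <= M * rnorm z) ->
  aap T (T x - x) ->
  cvg ((fun n => (iter n T x - x) - P (iter n T x - x)) @ \oo) -> aap T x.
Proof.
move=> nc0 TM ax /cvg_ex[l cl]; have [PA PL bP [PP PT Pr Pk]] := jP.
have dx := aap_increments ax.
have P0 : P 0 = 0 by have := jdlgB (aap0 T) (aap0 T); rewrite !subrr.
have [K PK] : exists K : R, forall z, aap T z -> rnorm (P z) <= K * rnorm z.
  have [K KP] := ereal_sup_lty_ub bP; exists K; apply: unit_ball_bound.
    move=> a z az; split; first exact: aapZ.
    by rewrite -[a *: z]addr0 PL// ?P0 ?addr0//; exact: aap0.
  by move=> z az z1; rewrite -lee_fin; apply: KP; exists z.
pose f n := P (iter n T x - x).
have tf : totally_bounded (range f).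
  apply: (@kadets _ _ T M TM f (`|K| * (M * rnorm x + rnorm x))) => //.
  - move=> n m; rewrite /f -jdlg_iter// iterB_linear -iterD.
    rewrite -[in LHS](subrKA (iter n T x)) addrC.
    have := PL 1 _ _ (dx n) (aap_iter n (dx m)).
    by rewrite !scale1r iterB_linear -iterD.
  - move=> n; apply: le_trans (PK _ (dx n)) _.
    apply: (@le_trans _ _ (`|K| * rnorm (iter n T x - x))).
      by rewrite ler_wpM2r ?rnorm_ge0// ler_norm.
    by rewrite ler_wpM2l//; apply: le_trans (rnormB _ _) _; rewrite lerD2r.
  - move=> n; apply: (recurrent_rev_part TM); rewrite -Pr.
    by exists (iter n T x - x).
apply: totally_bounded_precompact.
have -> : (fun n => iter n T x) =
    (fun n => x + (f n + ((iter n T x - x) - f n))).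
  by apply/funext => n; rewrite [f n + _]addrC subrK addrC subrK.
exact: totally_boundedD tf (cvg_totally_bounded cl).
Qed.

Theorem orbit_criterion (M : R) x : ~ contains_copy_of_c0 E ->
  (forall n z, rnorm (iter n T z) <= M * rnorm z) ->
  precompact (range (fun n => iter n T x)) <->
  precompact (range (fun n => iter n.+1 T x - iter n T x)) /\
  cvg ((fun n => (iter n T x - x) - P (iter n T x - x)) @ \oo).
Proof.
move=> nc0 TM.
have -> : (fun n => iter n.+1 T x - iter n T x) = (fun n => iter n T (T x - x)).
  by apply/funext => n; rewrite iterB_linear -iterSr.
split=> [ax|[dx cx]]; last exact: aap_of_increments nc0 TM dx cx.
split; last exact: aap_complement_cvg.
by apply: (aapB (T := T)) => //; exact: (aap_iter 1).
Qed.
End OrbitCriterion.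

(** * Rotations of a copy of the null sequences *)

Section UnimodularNumbers.
Local Open Scope complex_scope.
Context {R : realType}.

(** The Cayley transform of [1 / n]: unimodular numbers tending to [1], where
    the convention [0^-1 = 0] gives the value [1] at [n = 0]. *)
Definition turn (n : nat) : R[i] := (1 +i* n%:R^-1) / (1 -i* n%:R^-1).

Let den_neq0 (n : nat) : (1 -i* n%:R^-1 : R[i]) != 0.
Proof. by rewrite eq_complex /= oner_eq0. Qed.

Lemma turn0 : turn 0 = 1.
Proof. by rewrite /turn invr0 oppr0 divr1. Qed.

Lemma normr_turn n : `|turn n| = 1.
Proof.
rewrite normrM normfV; have -> : `|1 -i* n%:R^-1| = `|1 +i* n%:R^-1 : R[i]|.
  exact: (normcJ (1 +i* n%:R^-1)).
rewrite divff// normr_eq0 eq_complex /= oner_eq0//.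
Qed.

Lemma turn_subr1 n : turn n - 1 = (0 +i* (2 * n%:R^-1)) / (1 -i* n%:R^-1).
Proof.
rewrite -[X in _ - X](divff (den_neq0 n)) -mulrBl; congr (_ / _).
by apply/eqP; rewrite eq_complex /=; apply/andP; split; apply/eqP; ring.
Qed.

Lemma turn_neq1 n : turn n.+1 != 1.
Proof.
rewrite -subr_eq0 turn_subr1 mulf_neq0 ?invr_eq0//.
by rewrite eq_complex /= negb_and mulf_neq0 ?orbT// invr_eq0 pnatr_eq0.
Qed.

Lemma rnorm_turn_subr1 n : rnorm (turn n - 1 : R[i]^o) <= 2 * n%:R^-1.
Proof.
rewrite turn_subr1; set a := 0 +i* _; set b := 1 -i* _.
have ab : rnorm (a / b : R[i]^o) * rnorm (b : R[i]^o) = rnorm (a : R[i]^o).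
  by rewrite -rnormM divfK// den_neq0.
have b1 : 1 <= rnorm (b : R[i]^o) by exact: (Re_le_rnorm b).
have -> : 2 * n%:R^-1 = rnorm (a : R[i]^o).
  by rewrite /rnorm normc_def /= expr0n /= add0r sqrtr_sqr ger0_norm.
by rewrite -ab; have := rnorm_ge0 (a / b : R[i]^o); nra.
Qed.

Lemma turn_cvg1 (e : R) : 0 < e ->
  exists N, forall n, (N <= n)%N -> rnorm (turn n - 1 : R[i]^o) < e.
Proof.
move=> e0; exists (Num.bound (2 / e)).+1 => n; set N := Num.bound _ => Nn.
have e2 : 2 / e < n%:R.
  apply: (@lt_le_trans _ _ N%:R); last by rewrite ler_nat ltnW.
  by apply: archi_boundP; rewrite divr_ge0 ?ltW.
apply: le_lt_trans (rnorm_turn_subr1 n) _.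
rewrite ltr_pdivrMr; first by move: e2; rewrite ltr_pdivrMr// mulrC.
by rewrite ltr0n; apply: leq_trans Nn.
Qed.

Lemma rnorm_powerB1_le (lambda : R[i]) k : `|lambda| = 1 ->
  rnorm (lambda ^+ k - 1 : R[i]^o) <= k%:R * rnorm (lambda - 1 : R[i]^o).
Proof.
move=> l1; elim: k => [|k IHk]; first by rewrite subrr rnorm0 mul0r.
have -> : lambda ^+ k.+1 - 1 = lambda * (lambda ^+ k - 1) + (lambda - 1).
  by rewrite exprS mulrBr mulr1 subrKA.
apply: le_trans (rnormD (_ : R[i]^o) _) _.
by rewrite rnormM {1}/rnorm l1 mul1r mulrSr mulrDl mul1r lerD2r.
Qed.

(** If the powers of [lambda] stayed within [1 / 2] of [1], squaring would
    multiply the distance to [1] by at least [3 / 2]. *)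
Lemma power_far_from1 (lambda : R[i]) : lambda != 1 ->
  exists k, 1 / 2 <= rnorm (lambda ^+ k - 1 : R[i]^o).
Proof.
move=> l1; apply: contrapT => nk.
have {}nk k : rnorm (lambda ^+ k - 1 : R[i]^o) < 1 / 2.
  by rewrite ltNge; apply/negP => h; apply: nk; exists k.
pose r := rnorm (lambda - 1 : R[i]^o).
have r0 : 0 < r.
  rewrite lt_neqAle rnorm_ge0 andbT eq_sym; apply: contraNneq l1.
  by move=> /rnorm0_eq0/eqP; rewrite subr_eq0.
have grow j : (1 + j%:R / 2) * r <= rnorm (lambda ^+ (2 ^ j) - 1 : R[i]^o).
  elim: j => [|j IHj]; first by rewrite mul0r addr0 mul1r expr1.
  rewrite expnSr exprM -[X in _ - X](expr1n _ 2) subr_sqr rnormM.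
  set q := lambda ^+ _ in IHj *.
  have q2 : 3 / 2 <= rnorm (q + 1 : R[i]^o).
    have := rnorm_addB (2 : R[i]^o) (q - 1 : R[i]^o).
    have -> : 2 + (q - 1) = q + 1 by ring.
    have -> : rnorm (2 : R[i]^o) = 2.
      by rewrite -(rmorph_nat (real_complex R)) rnorm_real ger0_norm.
    by have := nk (2 ^ j)%N; rewrite -/q; lra.
  have j0 : 0 <= j%:R :> R by [].
  have := rnorm_ge0 (q - 1 : R[i]^o).
  by rewrite -natr1; nra.
have := grow (Num.bound r^-1); have := nk (2 ^ Num.bound r^-1)%N.
have : r^-1 < (Num.bound r^-1)%:R by apply: archi_boundP; rewrite invr_ge0 ltW.
rewrite -[r^-1]mul1r ltr_pdivrMr//; nra.
Qed.
End UnimodularNumbers.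

Section AlmostPeriodicClosure.
Local Open Scope complex_scope.
Context {R : realType} {E : completeNormedModType R[i]}.
Variables (T : {linear E -> E}) (M : R).
Hypothesis TM : forall n z, rnorm (iter n T z) <= M * rnorm z.

Lemma aap_closed : closed (aap T).
Proof.
move=> x /rclosureP xA; apply: totally_bounded_precompact => e e0.
have M1 : 0 < `|M| + 1 by rewrite ltr_wpDl.
have d0 : 0 < e / 2 / (`|M| + 1) by rewrite divr_gt0//; lra.
have e2 : 0 < e / 2 by lra.
have [y /precompact_totally_bounded/(_ _ e2)[s sP] xy] := xA _ d0.
exists s => _ [n _ <-]; have [|z zs yz] := sP (iter n T y); first by exists n.
exists z => //; apply: le_lt_trans (rnorm_distD (iter n T y) _ _) _.
rewrite -iterB_linear; have := TM n (x - y); have := ler_norm M.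
move: xy; rewrite ltr_pdivlMr//; have := rnorm_ge0 (x - y); nra.
Qed.

(** The orbit lies in the image of a compact square of the complex plane under
    [c |-> c *: v]. *)
Lemma aap_eigen (lambda : R[i]) v : `|lambda| = 1 -> T v = lambda *: v -> aap T v.
Proof.
move=> l1 Tv; pose g (p : R * R) : E := (p.1 +i* p.2) *: v.
have cg : continuous g.
  move=> p; apply/cvgrPdist_lt => _ /gt0_complex[e e0 ->].
  have v1 : 0 < rnorm v + 1 by rewrite ltr_wpDl ?rnorm_ge0.
  have d0 : 0 < e / 2 / (rnorm v + 1) by rewrite !divr_gt0.
  near=> q; rewrite norm_ltE /g -scalerBl rnormZ.
  have q1 : `|p.1 - q.1| < e / 2 / (rnorm v + 1).
    by near: q; apply: cvgr_dist_lt d0; exact: cvg_fst.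
  have q2 : `|p.2 - q.2| < e / 2 / (rnorm v + 1).
    by near: q; apply: cvgr_dist_lt d0; exact: cvg_snd.
  set c := (_ - _).
  have cE : c = (p.1 - q.1)%:C + 'i * (p.2 - q.2)%:C.
    by rewrite [LHS]complexE.
  have : rnorm (c : R[i]^o) <= `|p.1 - q.1| + `|p.2 - q.2|.
    rewrite cE; apply: le_trans (rnormD (_ : R[i]^o) _) _.
    by rewrite rnormM !rnorm_real rnorm_i mul1r.
  move: q1 q2; rewrite !ltr_pdivlMr//.
  by have := rnorm_ge0 (c : R[i]^o); have := rnorm_ge0 v; nra.
have cK : compact (g @` (`[(-1 : R), 1]%classic `*` `[(-1 : R), 1]%classic)).
  apply: continuous_compact; first exact: continuous_subspaceT.
  by apply: compact_setX; exact: segment_compact.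
apply: precompact_subset (compact_precompact (@norm_hausdorff _ E) cK).
move=> _ [n _ <-]; rewrite (iter_eigen _ Tv).
have : rnorm (lambda ^+ n : R[i]^o) = 1 by rewrite rnormX /rnorm l1 expr1n.
case: (lambda ^+ n) => a b ab1; exists (a, b) => //; split=> /=.
  by rewrite in_itv /= -ler_norml -ab1; exact: (normr_Re_le (a +i* b)).
by rewrite in_itv /= -ler_norml -ab1; exact: (normr_Im_le (a +i* b)).
Unshelve. all: by end_near. Qed.

Lemma rev_part_aap x : rev_part T x -> aap T x.
Proof.
move=> rx; apply: aap_closed; move: rx; apply: closure_subset.
move=> _ [n [c [v [vP ->]]]]; elim/big_ind: _ => [|y z|i _].
- exact: aap0.
- exact: aapD.
- by apply: aapZ; case: (vP i).
Qed.
End AlmostPeriodicClosure.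

Section RotatedCopy.
Local Open Scope complex_scope.
Context {R : realType} {E : completeNormedModType R[i]}.
Variables (J : {linear c0 R -> E}) (L K : R) (f : nat -> {linear E -> R[i]^o}).
Hypotheses (L0 : 0 <= L) (K0 : 0 <= K).
Hypothesis JL : forall u, rnorm (J u) <= L * rnorm u.
Hypothesis fJ : forall n u, f n (J u) = u n.
Hypothesis fK : forall n x, rnorm (f n x) <= K * rnorm x.

(** Adding [f 0] to the coordinate functionals does not change them on the
    sequences with [u 0 = 0], but gives those with [n > 0] the value [1] at the
    first unit vector, where the coordinates themselves vanish. *)
Let h n (z : E) : R[i]^o := f n z + f 0 z.

Let h_linear n : linear (h n).
Proof. by move=> a x y; rewrite /h !linearP scalerDr addrACA. Qed.

Let hD n x y : h n (x + y) = h n x + h n y.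
Proof. by rewrite /h !linearD addrACA. Qed.

Let hB n x y : h n (x - y) = h n x - h n y.
Proof. by rewrite /h !linearB opprD addrACA. Qed.

Let h_le n z : rnorm (h n z) <= 2 * K * rnorm z.
Proof.
apply: le_trans (rnormD _ _) _.
by have := fK n z; have := fK 0 z; lra.
Qed.

Let hJ n u : h n (J u) = u n + u 0%N.
Proof. by rewrite /h !fJ. Qed.

Let rotation_null z : (fun n => (turn n - 1) * h n z) \in @null_seq R.
Proof.
apply/null_seq_rP => e e0; pose c := 2 * K * rnorm z.
have c0 : 0 <= c by rewrite !mulr_ge0 ?rnorm_ge0.
have d0 : 0 < e / (c + 1) by apply: divr_gt0 => //; lra.
have [N NP] := turn_cvg1 d0; exists N => n /NP.
rewrite rnormM ltr_pdivlMr; last by lra.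
have := h_le n z; rewrite -/c; have := rnorm_ge0 (turn n - 1 : R[i]^o).
have := rnorm_ge0 (h n z); nra.
Qed.

Let rotation z : c0 R := C0 (rotation_null z).

(** The [n]-th coordinate is turned by the factor [turn n].  As [turn n] tends to
    [1], the increments belong to the copy of the null sequences even where the
    coordinates [h n z] do not tend to [0]. *)
Let rotate z := z + J (rotation z).

Let rotate_linear : linear rotate.
Proof.
move=> a x y; rewrite /rotate.
have -> : rotation (a *: x + y) = a *: rotation x + rotation y.
  apply: val_inj; apply/funext => n; rewrite /= h_linear.
  by rewrite mulrDr [_ * (a *: _)]mulrCA.
by rewrite linearP scalerDr addrACA.
Qed.

Let T : {linear E -> E} :=
  HB.pack rotate (GRing.isLinear.Build _ _ _ _ rotate rotate_linear).

Let hT n z : h n (T z) = turn n * h n z.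
Proof.
rewrite /= /rotate hD hJ /= turn0 subrr mul0r addr0.
by rewrite mulrBl mul1r addrC subrK.
Qed.

Let hTk k n z : h n (iter k T z) = turn n ^+ k * h n z.
Proof.
by elim: k => [|k IHk]; rewrite ?mul1r// iterS hT IHk mulrA -exprS.
Qed.

Let iter_rotate k z : exists v : c0 R, iter k T z = z + J v /\
  forall n, v n = (turn n ^+ k - 1) * h n z.
Proof.
elim: k => [|k [v [Tv vn]]].
  by exists 0; split=> [|n]; rewrite ?linear0 ?addr0// subrr mul0r.
exists (v + rotation (iter k T z)); split.
  by rewrite iterS /= /rotate linearD addrA -Tv.
move=> n; rewrite -[LHS]/(v n + (turn n - 1) * h n (iter k T z)) vn hTk exprS.
by rewrite mulrA -mulrDl; congr (_ * _); ring.
Qed.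

Let T_bound k z : rnorm (iter k T z) <= (1 + L * (4 * K)) * rnorm z.
Proof.
have [v [-> vn]] := iter_rotate k z; apply: le_trans (rnormD _ _) _.
rewrite mulrDl mul1r lerD2l -mulrA; apply: le_trans (JL _) _.
rewrite ler_wpM2l//; apply: rnorm_c0_le => n; rewrite vn rnormM.
have : rnorm (turn n ^+ k - 1 : R[i]^o) <= 2.
  apply: le_trans (rnormB (_ : R[i]^o) _) _.
  by rewrite rnormX {1}/rnorm normr_turn expr1n rnorm1.
have := h_le n z; have := rnorm_ge0 (h n z).
have := rnorm_ge0 (turn n ^+ k - 1 : R[i]^o); nra.
Qed.

Let T_fixed z : (forall n, h n.+1 z = 0) -> T z = z.
Proof.
move=> hz; rewrite /= /rotate; suff -> : rotation z = 0 by rewrite linear0 addr0.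
apply: val_inj; apply/funext => -[|n] /=; first by rewrite turn0 subrr mul0r.
by rewrite hz mulr0.
Qed.

(** A net of the orbit of [z] consists of finitely many powers, which rotate the
    late coordinates by almost nothing, while some other power rotates each of
    them by at least [1 / 2]. *)
Let aap_null z : aap T z -> (fun n => h n z) \in @null_seq R.
Proof.
move=> /precompact_totally_bounded tz; apply/null_seq_rP => e e0.
(* at a late coordinate, two powers whose rotations differ by [1 / 4] give points
   within [2 * d] of each other, hence [|h n z| / 4 <= 2 * K * (2 * d)] *)
pose d := e / (16 * (K + 1)).
have K1 : 0 < 16 * (K + 1) by rewrite mulr_gt0// ltr_wpDl.
have d0 : 0 < d by exact: divr_gt0.
have [s sP] := tz _ d0.
have /choice[k kP] : forall y, exists k, forall j,
    rnorm (iter j T z - y) < d -> rnorm (iter k T z - y) < d.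
  move=> y; have [[k ky]|nk] := pselect (exists k, rnorm (iter k T z - y) < d).
    by exists k.
  by exists 0%N => j jy; exfalso; apply: nk; exists j.
pose m := (\max_(y <- s) k y)%N.
have m0 : 0 < m.+1%:R :> R by [].
have [|N NP] := @turn_cvg1 R (1 / 4 / m.+1%:R); first by rewrite divr_gt0.
exists N.+1 => -[//|n]; rewrite ltnS => /leqW/NP turn_near.
have [j hj] := power_far_from1 (@turn_neq1 R n).
have [|y ys jy] := sP (iter j T z); first by exists j.
have ky := kP y j jy.
have hk : rnorm (turn n.+1 ^+ k y - 1 : R[i]^o) < 1 / 4.
  apply: le_lt_trans (rnorm_powerB1_le _ (normr_turn _)) _.
  apply: (@le_lt_trans _ _ (m.+1%:R * rnorm (turn n.+1 - 1 : R[i]^o))).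
    rewrite ler_wpM2r ?rnorm_ge0// ler_nat; apply: leqW.
    exact: leq_bigmax_seq.
  by move: turn_near; rewrite ltr_pdivlMr// mulrC.
have jk := rnorm_distD y (iter j T z) (iter (k y) T z).
have := h_le n.+1 (iter j T z - iter (k y) T z).
rewrite hB !hTk -mulrBl rnormM.
have far : 1 / 4 <= rnorm (turn n.+1 ^+ j - turn n.+1 ^+ k y : R[i]^o).
  have := rnorm_distD (turn n.+1 ^+ k y : R[i]^o) (turn n.+1 ^+ j : R[i]^o) 1.
  by lra.
have dK : d * (16 * (K + 1)) = e by rewrite divfK// gt_eqF.
move: jk; rewrite (rnormBC y) => jk.
have jk2 : rnorm (iter j T z - iter (k y) T z) <= 2 * d by lra.
have := ler_wpM2l K0 jk2; have := rnorm_ge0 (h n.+1 z); nra.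
Qed.

Lemma c0_sumE (I : Type) (s : seq I) (F : I -> c0 R) n :
  (\sum_(i <- s) F i : c0 R) n = \sum_(i <- s) F i n.
Proof. by elim/big_rec2: _ => // i y x _ <-. Qed.

Let unit_null k : (fun n => (n == k)%:R : R[i]^o) \in @null_seq R.
Proof.
apply/null_seq_rP => e e0; exists k.+1 => n kn.
by rewrite gt_eqF// rnorm0.
Qed.

Let unit_vec k : c0 R := C0 (unit_null k).

Let T_unit k : T (J (unit_vec k.+1)) = turn k.+1 *: J (unit_vec k.+1).
Proof.
rewrite /= /rotate; set u := unit_vec k.+1.
suff -> : rotation (J u) = (turn k.+1 - 1) *: u.
  by rewrite linearZ /= -{1}[J u]scale1r -scalerDl addrC subrK.
apply: val_inj; apply/funext => n.
rewrite -[LHS]/((turn n - 1) * h n (J u)) hJ -[RHS]/((turn k.+1 - 1) * u n) /=.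
by rewrite addr0; case: eqVneq => [->//|_]; rewrite !mulr0.
Qed.

(** The truncations of [u] give linear combinations of [w] and of the unit
    vectors other than the first one, which are eigenvectors by [T_unit]. *)
Let rev_part_null_fixed (u : c0 R) w : u 0%N = 0 -> T w = w ->
  rev_part T (J u + w).
Proof.
move=> u0 Tw; apply/rclosureP => e e0.
have L1 : 0 < L + 1 by rewrite ltr_wpDl.
have d0 : 0 < e / (L + 1) by exact: divr_gt0.
have /null_seq_rP/(_ _ d0)[N uN] := c0_valP u.
(* the index [0], where [u] vanishes, is used for the fixed vector [w] *)
exists (\sum_(i < N.+1) (if i == 0%N :> nat then 1 else u i) *:
                       (if i == 0%N :> nat then w else J (unit_vec i))).
  exists N.+1, (fun i => if i == 0%N :> nat then 1 else u i).
  exists (fun i => if i == 0%N :> nat then w else J (unit_vec i)); split=> //.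
  case=> -[|k] kN; rewrite [_ == _]/=.
    split; first exact: aap_fixed Tw.
    by exists 1; rewrite ?normr1// scale1r.
  split; first exact: aap_eigen (normr_turn _) (T_unit k).
  by exists (turn k.+1) => //; [exact: normr_turn|exact: T_unit].
rewrite big_ord_recl /= scale1r.
have -> : J u + w - (w + \sum_(i < N) u (bump 0 i) *: J (unit_vec (bump 0 i))) =
    J (u - \sum_(i < N) u i.+1 *: unit_vec i.+1).
  rewrite linearB linear_sum (addrC (J u)) opprD addrACA subrr add0r.
  by congr (_ - _); apply: eq_bigr => i _; rewrite linearZ.
apply: (@le_lt_trans _ _ (L * (e / (L + 1)))); last first.
  by rewrite mulrA ltr_pdivrMr//; nra.
apply: le_trans (JL _) _; rewrite ler_wpM2l//; apply: rnorm_c0_le => n.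
rewrite -[X in rnorm X]/(u n - (\sum_(i < N) u i.+1 *: unit_vec i.+1 : c0 R) n).
rewrite c0_sumE.
have termE (i : 'I_N) : (u i.+1 *: unit_vec i.+1) n = u i.+1 * (n == i.+1)%:R.
  by [].
case: n termE => [|n] termE.
  rewrite u0 big1 ?subrr ?rnorm0 ?ltW// => i _.
  by rewrite termE mulr0.
have [Nn|nN] := leqP N n.
  rewrite big1 ?subr0 => [|i _]; first by apply/ltW/uN/leqW.
  by rewrite termE eqSS gtn_eqF ?mulr0// (leq_trans (ltn_ord i)).
rewrite (bigD1 (Ordinal nN))// termE eqSS eqxx mulr1 big1 => [|i ni].
  by rewrite /= addr0 subrr rnorm0 ltW.
rewrite -val_eqE /= eq_sym in ni.
by rewrite termE eqSS (negPf ni) mulr0.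
Qed.

Let decompose z : (fun n => h n z) \in @null_seq R ->
  exists u : c0 R, u 0%N = 0 /\ T (z - J u) = z - J u.
Proof.
move=> hz; have u0 : (fun n => if n is 0 then 0 else h n z) \in @null_seq R.
  move/null_seq_rP: hz => hz; apply/null_seq_rP => e /hz[N NP].
  by exists N.+1 => -[//|n] /ltnW/NP.
exists (C0 u0); split=> //; apply: T_fixed => n.
by rewrite hB hJ /= addr0 subrr.
Qed.

(** An almost periodic vector is the sum of a null sequence in the copy, which
    is a limit of combinations of eigenvectors, and of a fixed vector. *)
Let aap_rev_part z : aap T z -> rev_part T z.
Proof.
move=> /aap_null/decompose[u [u0 Tw]].
by rewrite -[z](subrK (J u)) addrC; exact: rev_part_null_fixed.
Qed.

Let id_projection : jdlg_projection T id.
Proof.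
split=> //.
  by apply: (@bounded_opP _ _ _ _ 1) => // z _; rewrite mul1r.
split=> //.
  rewrite image_id; apply/seteqP; split=> z; first exact: aap_rev_part.
  by apply: rev_part_aap => k y; exact: T_bound.
apply/seteqP; split=> z /= [az] => [z0|Tz]; split=> //.
  rewrite z0; have -> : (fun n => iter n T 0) = (fun=> 0).
    by apply/funext; elim=> // n IHn; rewrite iterS IHn linear0.
  exact: cvg_cst.
have hz n : h n z = 0.
  apply: rnorm0_eq0; apply/le_anti; rewrite rnorm_ge0 andbT.
  apply/ler_addgt0Pr => e e0; rewrite add0r.
  have K1 : 0 < 2 * K + 1 by rewrite ltr_wpDl ?mulr_ge0.
  have d0 : 0 < e / (2 * K + 1) by exact: divr_gt0.
  have /rcvgP/(_ _ d0)[N /(_ N (leqnn N))] := Tz.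
  rewrite subr0 ltr_pdivlMr// => Ne.
  have := h_le n (iter N T z); rewrite hTk rnormM rnormX.
  rewrite {1}/rnorm normr_turn expr1n mul1r.
  have := rnorm_ge0 (iter N T z); lra.
have zfix : T z = z by exact: T_fixed.
have iz : (fun n => iter n T z) = (fun=> z).
  by apply/funext; elim=> // n IHn; rewrite iterS IHn zfix.
apply/esym/(@cvg_unique _ (@norm_hausdorff _ E) _ _ _ _ Tz).
by rewrite iz; exact: cvg_cst.
Qed.

(** The orbit of the first unit vector is not relatively compact, its values
    under the [h n] with [n > 0] being [1], although its increments are almost
    periodic and the projection onto the reversible part is the identity. *)
Theorem rotated_copy_counterexample : exists (T : {linear E -> E}) (x : E),
  [/\ bounded_op setT T, power_bounded T, jdlg_projection T id,
    aap T (T x - x) & ~ aap T x].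
Proof.
have M0 : 0 <= 1 + L * (4 * K) by rewrite addr_ge0// !mulr_ge0.
exists T, (J (unit_vec 0)); split.
- by apply: (@bounded_opP _ _ _ _ _ M0) => z _; exact: (T_bound 1).
- by apply: (@power_boundedP _ _ _ _ M0) => n z; exact: T_bound.
- exact: id_projection.
- set x := J (unit_vec 0); have -> : T x - x = J (rotation x).
    by rewrite /= /rotate addrAC subrr add0r.
  apply: (rev_part_aap (M := 1 + L * (4 * K))) => [k z|]; first exact: T_bound.
  rewrite -[J _]addr0; apply: rev_part_null_fixed; last by rewrite linear0.
  by rewrite -[LHS]/((turn 0 - 1) * h 0 x) turn0 subrr mul0r.
move=> /aap_null/null_seq_rP/(_ _ ltr01)[N NP].
have := NP N.+1 (leqnSn N); rewrite hJ /= add0r rnorm1 ltxx//.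
Qed.
End RotatedCopy.

(** * The characterization *)

Theorem corollary12 (R : realType) (E : completeNormedModType R[i])
    (sepE : separable_space E) :
  ~ contains_copy_of_c0 E <->
  (forall T : {linear E -> E}, bounded_op setT T -> power_bounded T ->
   forall P : E -> E, jdlg_projection T P ->
   forall x : E,
     precompact (range (fun n => iter n T x)) <->
     precompact (range (fun n => iter n.+1 T x - iter n T x)) /\
     cvg ((fun n => (iter n T x - x) - P (iter n T x - x)) @ \oo)).
Proof.
split=> [nc0 T _ /power_bounded_ub[M TM] P jP x|orbits].
  exact: (orbit_criterion jP x nc0 TM).
move=> /contains_copy_elim[J [L [K [L0 K0 JL JK]]]].
have [f [fJ fK]] := extended_coordinates K0 JK.
have [T [x [bT pT jT dx nx]]] := rotated_copy_counterexample L0 K0 JL fJ fK.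
apply/nx/(orbits T bT pT id jT x); split.
  have -> // : (fun n => iter n.+1 T x - iter n T x) =
    (fun n => iter n T (T x - x)).
  by apply/funext => n; rewrite iterB_linear -iterSr.
have -> : (fun n => iter n T x - x - id (iter n T x - x)) = (fun=> 0).
  by apply/funext => n; rewrite subrr.
exact: is_cvg_cst.
Qed.
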